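(* Let $R(x)=g(x)/h(x)$ be a cubic rational expression over a finite field $\mathbb{F}_q$ with four ramification points (over the algebraic closure $\overline{\mathbb{F}}_q$). Then, for integers $n>1$, \[ |\mathcal{I}(g,h,n,q)|=\frac{q^n}{3n}+O\!\left(\frac{q^{n/2}}{n}\right), \] with an absolute implied constant.
   Context: A cubic rational expression over $\mathbb{F}_q$ is $R(x)=g(x)/h(x)$ with $g,h\in\mathbb{F}_q[x]$ coprime and $\max(\deg g,\deg h)=3$. The ramification points of $R$ (over $\overline{\mathbb{F}}_q$) are the zeros in $\overline{\mathbb{F}}_q$ of the polynomial $g'(x)h(x)-g(x)h'(x)$, together with $\infty$ in case this polynomial has degree less than $2\deg R-2=4$. ''Four ramification points'' means four distinct ones. For an integer $n>1$, $\mathcal{I}(g,h,n,q)$ denotes the set of monic irreducible polynomials $f\in\mathbb{F}_q[x]$ of degree $n$ such that $h(x)^n f\bigl(g(x)/h(x)\bigr)$ is irreducible in $\mathbb{F}_q[x]$. *)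

(* Defs.v *)
From HB Require Import structures.
From mathcomp Require Import all_boot all_order all_algebra.
From mathcomp Require Import qpoly fraction mxpoly.

Set Implicit Arguments.
Unset Strict Implicit.
Unset Printing Implicit Defensive.

Import GRing.Theory.
Local Open Scope ring_scope.

Section RationalExpressions.
Variable F : fieldType.
Implicit Types f g h : {poly F}.

Definition ratdeg g h : nat := (maxn (size g) (size h)).-1.

Definition cubic_ratexpr g h : bool := coprimep g h && (ratdeg g h == 3).

(* Numerator of the derivative of g / h. *)
Definition ram_poly g h : {poly F} := g^`() * h - g * h^`().

(* None is the point at infinity of the projective line over K.  As
   size p = deg p + 1 (and size 0 = 0), size p <= d means deg p < d. *)
Definition is_ram_point (K : fieldType) (iota : {rmorphism F -> K}) g h
    (P : option K) : bool :=
  if P is Some a then root (map_poly iota (ram_poly g h)) a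
  else (size (ram_poly g h) <= 2 * ratdeg g h - 2)%N.

(* In particular the set of ramification points is finite, which excludes the
   inseparable case ram_poly g h = 0. *)
Definition has_nb_ram_points (K : fieldType) (iota : {rmorphism F -> K}) g h
    (m : nat) : Prop :=
  exists s : seq (option K),
    [/\ uniq s, size s = m & forall P, (P \in s) = is_ram_point iota g h P].

(* The polynomial h^n f(g/h), for f of degree at most n; see ratsubstE. *)
Definition ratsubst g h n f : {poly F} :=
  \sum_(i < n.+1) f`_i *: (g ^+ i * h ^+ (n - i)).

Local Notation tofrac := (@FracField.tofrac {poly F}).

Lemma ratsubstE g h n f : h != 0 -> (size f <= n.+1)%N ->
  tofrac (ratsubst g h n f) =
  tofrac h ^+ n * (map_poly (tofrac \o polyC) f).[tofrac g / tofrac h].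
Proof.
move=> h0 sf; have hF0 : tofrac h != 0 by rewrite tofrac_eq0.
rewrite (horner_coef_wide _ (leq_trans (size_poly _ _) sf)) mulr_sumr.
rewrite rmorph_sum; apply: eq_bigr => i _.
rewrite coef_map /= -mul_polyC !rmorphM /= !rmorphXn /=.
rewrite [RHS]mulrCA; congr (_ * _).
have le_in : (i <= n)%N by rewrite -ltnS.
have -> : tofrac h ^+ n = tofrac h ^+ (n - i) * tofrac h ^+ i.
  by rewrite -exprD subnK.
by rewrite expr_div_n -mulrA [_ ^+ i * (_ / _)]mulrC divfK ?expf_neq0 // mulrC.
Qed.

End RationalExpressions.

(* I(g, h, n, q); the type {poly_n.+1 F} of polynomials of degree at most n is
   finite, and irreducibleb reflects irreducible_poly. *)
Definition irr_set (F : finFieldType) (g h : {poly F}) (n : nat) :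
    {set {poly_n.+1 F}} :=
  [set f : {poly_n.+1 F} | [&& size (f : {poly F}) == n.+1,
     (f : {poly F}) \is monic, irreducibleb (f : {poly F})
   & irreducibleb (ratsubst g h n f)]].

(* K being closed, only algebraicity over F is left to require; integral over a
   field means algebraic. *)
Definition is_algebraic_closure (F : fieldType) (K : closedFieldType)
    (iota : {rmorphism F -> K}) : Prop := integralRange iota.

(* Main.v *)
Require Import Defs.
From HB Require Import structures.
From mathcomp Require Import all_boot all_order all_algebra all_field.
From mathcomp Require Import qpoly ring lra zify reals exp.
Set Implicit Arguments.
Unset Strict Implicit.
Unset Printing Implicit Defensive.
Import Order.TTheory GRing.Theory Num.Theory.
Local Open Scope ring_scope.

(** Let q be the cardinal of F, L the extension of F of degree n, Q = q^n, and
    a in L a root of a monic irreducible f of degree n.  Every irreducible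
    factor of h^n f(g/h) has degree divisible by n, since it has a root z with
    g(z)/h(z) a root of f, and its degree is n only if it has a root in L.  The
    total degree being 3n, this polynomial is irreducible exactly when it has
    no root in L, that is, when a is not a value on L of R = g/h
    ([irreducible_ratsubst], [ratsubst_conjugate]).  Each f has n roots in L,
    and at most 2 q^(n/2) elements of L have degree less than n, so it is
    enough to show that R omits Q/3 + O(sqrt Q) values on L
    ([card_irr_set], [card_small_degree], [card_ratimgC]).

    For x in L, the other points of the fibre of x are the roots of a quadratic
    polynomial, the Bezoutian of g and h with one variable set to x.  Let D(x)
    be its discriminant, a polynomial of degree at most 4.  Up to boundedly
    many x, the fibre of x has three points if D(x) is a square and one
    otherwise.  If each case occurs for Q/2 + O(sqrt Q) elements x, then R takes
    Q/6 + Q/2 = 2Q/3 values up to O(sqrt Q).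

    The equidistribution of the quadratic character of D is Hasse's bound for
    the curve y^2 = D(x), up to the value of the constant.  It is obtained by
    Stepanov's method ([stepanov_bound]): a nonzero polynomial of degree about
    t Q is constructed that vanishes to order 2t, with t about sqrt(Q)/2, at all
    the points where D^((Q-1)/2) takes a given value 1 or -1.  Both values
    are bounded from above, which yields the bounds from below.

    The method requires that D is not a constant times a square.  This is where
    the four ramification points are used.  Being simple zeros of the
    ramification form of degree four, they exclude characteristic two, and an
    explicit computation shows that a double zero of D, possibly at infinity,
    is also a double zero of that form ([double_root_at0]); hence D is
    separable of degree at least 3 ([generic_ratexpr_ram4]). *)

(** * Hasse derivatives over a finite field *)
Lemma nderivnM (R : comNzRingType) (p q : {poly R}) k :
  (p * q)^`N(k) = \sum_(i < k.+1) p^`N(i) * q^`N(k - i).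
Proof.
elim/poly_ind: p k => [|p c IHp] k.
  rewrite mul0r linear0 big1 // => i _; by rewrite linear0 mul0r.
have dX (u : {poly R}) j : (u * 'X)^`N(j.+1) = u^`N(j) + u^`N(j.+1) * 'X.
  by rewrite -[u * 'X]addr0 -[0 in LHS]polyC0 nderivnMXaddC.
have dC j : (c%:P * q)^`N(j) = c%:P * q^`N(j).
  by rewrite !mul_polyC nderivnZ.
rewrite mulrDl nderivnD dC mulrAC.
case: k => [|k].
  by rewrite big_ord1 subn0 !nderivn0 mulrDl mulrAC.
rewrite dX !IHp [RHS]big_ord_recl /= nderivn0 mulrDl.
under [in RHS]eq_bigr => i _ do
  rewrite /bump /= add1n nderivnMXaddC subSS mulrDl.
rewrite big_split /= [X in (_ + X * 'X) + _]big_ord_recl /= nderivn0 subn0.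
under [X in _ + (_ + X) * 'X + _]eq_bigr => i _ do rewrite /bump /= add1n subSS.
rewrite mulrDl mulr_suml.
under [X in _ + (_ + X) + _]eq_bigr => i _ do rewrite mulrAC.
by rewrite [p * 'X * _]mulrAC; ring.
Qed.

Lemma finField_card_pnat (F : finFieldType) : [pchar F].-nat #|F|.
Proof.
have [p p_pr pcharp] := finPcharP F.
rewrite (card_pprimeChar pcharp) (eq_pnat _ (pcharf_eq pcharp)).
by rewrite pnatX pnat_id.
Qed.

Lemma exprD_card_poly (F : finFieldType) (u v : {poly F}) :
  (u + v) ^+ #|F| = u ^+ #|F| + v ^+ #|F|.
Proof.
by apply: exprDn_pchar; rewrite (eq_pnat _ (pchar_poly F)) finField_card_pnat.
Qed.

(** The binomial coefficients of exponent q vanish in F, because raising to the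
    power q is additive.  Hasse derivatives of order below q therefore treat
    the powers of 'X^q as constants. *)
Lemma nderivn_Xcard_eq0 (F : finFieldType) k : (0 < k < #|F|)%N ->
  ('X^#|F| : {poly F})^`N(k) = 0.
Proof.
move=> /andP[k0 kq]; rewrite nderivnXn.
have /(congr1 (fun u : {poly F} => u`_k)) := exprD_card_poly (1 : {poly F}) 'X.
rewrite exprDn coef_sum (bigD1 (inord k)) //= inordK ?ltnS 1?ltnW //.
rewrite big1 => [|i /eqP ik]; last first.
  rewrite expr1n mul1r coefMn coefXn; case: eqP => [ki|]; last by rewrite mul0rn.
  by case: ik; apply/val_inj; rewrite /= inordK -?ki // ltnS ltnW.
rewrite !expr1n mul1r coefMn coefXn eqxx addr0 coefD coef1 coefXn.
rewrite (gtn_eqF k0) (ltn_eqF kq) addr0 => bin0.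
by rewrite -mulr_natr -polyC_natr bin0 mulr0.
Qed.

Lemma nderivn_Xcard_expM (F : finFieldType) (u : {poly F}) j k : (k < #|F|)%N ->
  (('X^#|F| ^+ j) * u)^`N(k) = ('X^#|F| ^+ j) * u^`N(k).
Proof.
move=> kq; elim: j => [|j IHj]; first by rewrite expr0 !mul1r.
rewrite exprS -!mulrA nderivnM big_ord_recl /= nderivn0 subn0 IHj.
rewrite big1 ?addr0 // => i _.
by rewrite nderivn_Xcard_eq0 ?mul0r // /bump /= (leq_ltn_trans _ kq) // add1n.
Qed.

(** Taylor expansion at x.  Hasse derivatives are used instead of iterated
    ones since the order of vanishing may exceed the characteristic. *)
Lemma dvdp_XsubC_exp_nderivn (F : fieldType) (p : {poly F}) x l :
  (forall k, (k < l)%N -> p^`N(k).[x] = 0) -> ('X - x%:P) ^+ l %| p.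
Proof.
move=> p0; have pE : p = \sum_(i < size p) p^`N(i).[x] *: ('X - x%:P) ^+ i.
  have := @nderiv_taylor _ (map_poly polyC p) x%:P ('X - x%:P) (mulrC _ _).
  rewrite subrKC -/(comp_poly 'X p) comp_polyXr.
  rewrite size_map_polyC => {1}->; apply: eq_bigr => i _.
  by rewrite nderivn_map horner_map /= mul_polyC.
rewrite pE; elim/big_ind: _ => [|u v|i _]; [exact: dvdp0|exact: dvdp_add|].
case: (ltnP i l) => [/p0->|li]; first by rewrite scale0r dvdp0.
by rewrite -mul_polyC dvdp_mull ?dvdp_exp2l.
Qed.

Lemma size_multiple_roots (F : fieldType) (p : {poly F}) (s : seq F) l :
  p != 0 -> uniq s -> (forall x, x \in s -> ('X - x%:P) ^+ l %| p) ->
  (size s * l < size p)%N.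
Proof.
move=> p0 us sp.
have dvd : \prod_(x <- s) ('X - x%:P) ^+ l %| p.
  elim: s us sp => [|x s IHs] /=; first by rewrite big_nil dvd1p.
  move=> /andP[xs us] sp; rewrite big_cons Gauss_dvdp.
    rewrite sp ?mem_head // IHs // => y ys; apply: sp; by rewrite inE ys orbT.
  rewrite prodrXl coprimep_expl // coprimep_expr // coprimep_sym coprimep_XsubC.
  by rewrite root_prod_XsubC.
have := dvdp_leq p0 dvd; rewrite prodrXl.
have := size_exp (\prod_(x <- s) ('X - x%:P)) l; rewrite size_prod_XsubC /= => <-.
rewrite -[X in (X <= _)%N -> _]prednK // lt0n size_poly_eq0 expf_neq0 //.
exact/monic_neq0/monic_prod_XsubC.
Qed.

(** * Derivatives of a multiple of a power *)
Section HasseQuotient.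
Variables (F : fieldType) (f : {poly F}).
Hypothesis f0 : f != 0.

(** A Hasse derivative of order k of f ^+ c * s loses at most k factors f, so it
    is a multiple of f ^+ (c - k) when k <= c, and this is the quotient; the
    factor f ^+ k avoids the subtraction.  The quotient is linear in s and its
    degree grows by a bounded amount per derivative, whatever c is: this keeps
    the number of vanishing conditions small although c is about half of q. *)
Definition hasse_quo c k s : {poly F} := (f ^+ k * (f ^+ c * s)^`N(k)) %/ f ^+ c.

Lemma hasse_quoD c k : {morph hasse_quo c k : s t / s + t}.
Proof. by move=> s t; rewrite /hasse_quo mulrDr nderivnD mulrDr divpD. Qed.

(** Leibniz formula for f * (f ^+ c * s): the term where the extra factor f is
    not differentiated is f times the previous quotient, and each of the i.+1
    derivatives falling on that factor is paid for by a power of f. *)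
Lemma hasse_quo_rec c k s :
    (forall j, f ^+ j * (f ^+ c * s)^`N(j) = f ^+ c * hasse_quo c j s) ->
  f ^+ k * (f ^+ c.+1 * s)^`N(k) =
    f ^+ c.+1 * (hasse_quo c k s +
      \sum_(i < k) f ^+ i * f^`N(i.+1) * hasse_quo c (k - i.+1) s).
Proof.
move=> IH; rewrite exprS -mulrA nderivnM big_ord_recl nderivn0 subn0.
rewrite !mulrDr mulrCA IH mulrA; congr (_ + _).
rewrite !mulr_sumr; apply: eq_bigr => i _; rewrite lift0.
have -> : f ^+ k = f * f ^+ i * f ^+ (k - i.+1).
  by rewrite -exprS -exprD subnKC.
transitivity (f * f ^+ i * f^`N(i.+1) *
    (f ^+ (k - i.+1) * (f ^+ c * s)^`N(k - i.+1))); first by ring.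
by rewrite IH; ring.
Qed.

Lemma hasse_quoE c k s : f ^+ k * (f ^+ c * s)^`N(k) = f ^+ c * hasse_quo c k s.
Proof.
elim: c k => [|c IHc] k; first by rewrite /hasse_quo expr0 !mul1r divp1.
rewrite [in RHS]/hasse_quo (hasse_quo_rec _ IHc).
by rewrite [X in _ = _ * (X %/ _)]mulrC mulpK ?expf_neq0.
Qed.

Lemma size_hasse_quo m c k s : (size f <= m.+2)%N ->
  (size (hasse_quo c k s) <= size s + m * k)%N.
Proof.
move=> sf; have sfX i : (size (f ^+ i)%R <= m.+1 * i + 1)%N.
  by apply: leq_trans (size_poly_exp_leq _ _) _; nia.
elim: c k => [|c IHc] k.
  rewrite /hasse_quo expr0 mul1r divp1.
  have [->|nz] := eqVneq (s^`N(k)) 0; first by rewrite mulr0 size_poly0.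
  apply: leq_trans (size_polyMleq _ _) _.
  have : (size (s^`N(k))%R <= size s - k)%N by exact: size_poly.
  move: nz; rewrite -size_poly_gt0; have := sfX k; nia.
have -> : hasse_quo c.+1 k s = hasse_quo c k s +
      \sum_(i < k) f ^+ i * f^`N(i.+1) * hasse_quo c (k - i.+1) s.
  apply: (@mulfI _ (f ^+ c.+1)); first by rewrite expf_neq0.
  by rewrite -hasse_quoE hasse_quo_rec // => j; rewrite hasse_quoE.
apply: leq_trans (size_polyD _ _) _; rewrite geq_max IHc /=.
apply: leq_trans (size_sum _ _ _) _; apply/bigmax_leqP => i _.
have [->|nz] := eqVneq (f^`N(i.+1)) 0; first by rewrite mulr0 mul0r size_poly0.
have [->|nz'] := eqVneq (hasse_quo c (k - i.+1) s) 0.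
  by rewrite mulr0 size_poly0.
apply: leq_trans (size_polyMleq _ _) _.
have := size_polyMleq (f ^+ i) f^`N(i.+1).
have : (size (f^`N(i.+1))%R <= size f - i.+1)%N by exact: size_poly.
have := IHc (k - i.+1)%N; have := sfX i.
have -> : (m * k = m * (k - i.+1) + m * i + m)%N.
  by rewrite -mulnDr -mulnSr -addnS subnK.
rewrite mulSn; move: nz nz'; rewrite -!size_poly_gt0.
move: (size (f ^+ i * f^`N(i.+1))%R) (size (f ^+ i)) (size f^`N(i.+1)) 
  => a1 a2 a3.
move: (size (hasse_quo c (k - i.+1) s)) (size f) sf (size s) => a4 a5 ? a6.
move: (m * (k - i.+1))%N (m * i)%N (nat_of_ord i) => a7 a8 a9; lia.
Qed.

End HasseQuotient.

(** * Stepanov's method for the equation y^2 = f(x) *)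
Section SizeBounds.
Variable F : fieldType.
Implicit Types p q : {poly F}.

Lemma size_mul_le p q a b d : (size p <= a)%N -> (size q <= b)%N ->
    (a + b <= d.+1)%N ->
  (size (p * q)%R <= d)%N.
Proof.
move=> pa qb abd; apply: leq_trans (size_polyMleq _ _) _.
by rewrite -subn1 leq_subLR add1n (leq_trans (leq_add pa qb)).
Qed.

Lemma size_exp_le p n a : (size p <= a.+1)%N -> (size (p ^+ n) <= (a * n).+1)%N.
Proof.
move=> pa; apply: leq_trans (size_poly_exp_leq _ _) _.
by rewrite ltnS leq_mul2r -subn1 leq_subLR add1n pa orbT.
Qed.

Lemma size_add_le p q d : (size p <= d)%N -> (size q <= d)%N ->
    (size (p + q)%R <= d)%N.
Proof. by move=> pd qd; rewrite (leq_trans (size_polyD _ _)) // geq_max pd. Qed.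

Lemma size_scale_le (a : F) p d : (size p <= d)%N -> (size (a *: p) <= d)%N.
Proof. exact: leq_trans (size_scale_leq _ _). Qed.
End SizeBounds.

(** Equivalently, f is not a constant times the square of a rational function. *)
Definition not_scaled_square (F : fieldType) (f : {poly F}) :=
  forall (b : F) (r s : {poly F}), b != 0 -> r ^+ 2 * f = b *: s ^+ 2 -> r = 0.

Section Stepanov.
Variables (F : finFieldType) (c : nat).
Hypotheses (oF : #|F| = c.*2.+1) (c_gt1 : (1 < c)%N).
Local Notation Q := #|F|.
Implicit Types (f r s : {poly F}).

(** If r + f ^+ c * s vanishes modulo 'X^q, multiply it by its conjugate
    r - f ^+ c * s and by f: since f ^+ q is f(0)^q modulo 'X^q, this gives
    r ^+ 2 * f = f(0)^q * s ^+ 2 modulo 'X^q, hence exactly, for degree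
    reasons. *)
Lemma stepanov_indep_mod f r s : not_scaled_square f -> f.[0] != 0 ->
  (size f <= 5)%N -> (size r < c)%N -> (size s < c)%N ->
  'X^Q %| r + f ^+ c * s -> r = 0 /\ s = 0.
Proof.
move=> nsq f00 sf sr ss dvd.
have f_n0 : f != 0 by apply: contraNneq f00 => ->; rewrite horner0.
have fQ : 'X^Q %| f ^+ Q - (f.[0] ^+ Q)%:P.
  have /factor_theorem[f1] : root (f - f.[0]%:P) 0.
    by rewrite /root !hornerE subrr.
  move=> /(canRL (subrK _)) fE; rewrite {1}fE exprD_card_poly polyC_exp addrK.
  by rewrite subr0 exprMn dvdp_mulIr.
have E : r ^+ 2 * f - f.[0] ^+ Q *: s ^+ 2 = 0.
  apply/eqP; apply: contraTT dvd => nz; apply/negP => dvd.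
  suff /dvdp_leq : 'X^Q %| r ^+ 2 * f - f.[0] ^+ Q *: s ^+ 2.
    move=> /(_ nz); rewrite size_polyXn; apply/negP; rewrite -ltnNge ltnS oF.
    have sq2 (v : {poly F}) : (size v < c)%N ->
        (size (v ^+ 2) <= (c.-2 * 2).+1)%N.
      by move=> vc; apply: size_exp_le; case: (c) c_gt1 vc => [|[]].
    apply: size_add_le; first by apply: size_mul_le (sq2 _ sr) sf _; lia.
    by rewrite size_polyN; apply: size_scale_le; apply: leq_trans (sq2 _ ss) _;
        lia.
  have -> : r ^+ 2 * f - f.[0] ^+ Q *: s ^+ 2 =
     (r + f ^+ c * s) * ((r - f ^+ c * s) * f) +
     (f ^+ Q - (f.[0] ^+ Q)%:P) * s ^+ 2.
    have -> : f ^+ Q = f * (f ^+ c * f ^+ c) by rewrite -exprD addnn -exprS -oF.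
    rewrite -mul_polyC; ring.
  by rewrite dvdp_add // dvdp_mulr.
have r0 : r = 0.
  by apply: nsq (subr0_eq E); rewrite expf_neq0.
split=> //; move: E; rewrite r0 expr0n mul0r sub0r => /eqP.
by rewrite oppr_eq0 scaler_eq0 expf_eq0 (negPf f00) andbF /= sqrf_eq0 => /eqP.
Qed.

(** The coefficients of a combination of powers of 'X^q are recovered one at a
    time, by reduction modulo 'X^q followed by division by 'X^q. *)
Lemma stepanov_indep f (r s : nat -> {poly F}) J :
    not_scaled_square f -> f.[0] != 0 -> (size f <= 5)%N ->
    (forall j, size (r j) < c)%N -> (forall j, size (s j) < c)%N ->
  \sum_(j < J) 'X^Q ^+ j * (r j + f ^+ c * s j) = 0 ->
  forall j, (j < J)%N -> r j = 0 /\ s j = 0.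
Proof.
move=> nsq f00 sf; elim: J r s => // J IHJ r s sr ss.
rewrite big_ord_recl expr0 mul1r => E.
have E2 : \sum_(j < J) 'X^Q ^+ (lift ord0 j) *
     (r (lift ord0 j) + f ^+ c * s (lift ord0 j)) =
  'X^Q * \sum_(j < J) 'X^Q ^+ j * (r j.+1 + f ^+ c * s j.+1).
  by rewrite mulr_sumr; apply: eq_bigr => j _; rewrite lift0 mulrA -exprS.
rewrite E2 in E.
have [r0 s0] : r 0%N = 0 /\ s 0%N = 0.
  apply: (stepanov_indep_mod nsq) => //.
  by move: E => /(canRL (addrK _)); rewrite sub0r => ->; rewrite dvdpNr
      dvdp_mulIl.
move: E; rewrite /= r0 s0 mulr0 addr0 add0r => /eqP.
rewrite mulf_eq0 -size_poly_eq0 size_polyXn /= => E.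
case=> [|j]; first by rewrite r0 s0.
rewrite ltnS; apply: (IHJ (r \o S) (s \o S)) => [i|i|]; first exact: sr.
  exact: ss.
exact/eqP.
Qed.

(** The auxiliary polynomial, whose coefficients are the rows of u.1 and u.2.
    At a point x with f(x)^c = a one has x^q = x, so that its Hasse derivative
    of order k is, up to a power of f(x), the value at x of the polynomial
    stepanov_cond, of much smaller degree. *)
Definition stepanov_poly f J A (u : 'M[F]_(J, A) * 'M[F]_(J, A)) : {poly F} :=
  \sum_(j < J) 'X^Q ^+ j * (rVpoly (row j u.1) + f ^+ c * rVpoly (row j u.2)).

Definition stepanov_cond f (a : F) J A k (u : 'M[F]_(J, A) * 'M[F]_(J, A))
    : {poly F} :=
  \sum_(j < J) 'X^j * (hasse_quo f 0 k (rVpoly (row j u.1)) +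
                       a *: hasse_quo f c k (rVpoly (row j u.2))).

Lemma stepanov_condB f a J A k :
  {morph @stepanov_cond f a J A k : u v / u - v}.
Proof.
have hqN b r : hasse_quo f b k (- r) = - hasse_quo f b k r.
  apply/eqP; rewrite -addr_eq0 -hasse_quoD addNr.
  by rewrite /hasse_quo mulr0 linear0 mulr0 div0p.
move=> u v; rewrite /stepanov_cond -sumrB; apply: eq_bigr => j _.
rewrite !linearB /= !hasse_quoD !hqN scalerDr scalerN.
by rewrite -mulrBr; congr (_ * _); rewrite opprD addrACA.
Qed.

Lemma size_stepanov_cond f a J A k u : f != 0 -> (size f <= 5)%N ->
  (size (@stepanov_cond f a J A k u) <= A + 3 * k + J)%N.
Proof.
move=> f0 sf; apply: leq_trans (size_sum _ _ _) _; apply/bigmax_leqP => j _.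
have sz b (w : 'rV[F]_A) : (size (hasse_quo f b k (rVpoly w)) <= A + 3 * k)%N.
  apply: leq_trans (size_hasse_quo f0 _ _ _ sf) _.
  by rewrite leq_add2r size_poly.
apply: size_mul_le (eq_leq (size_polyXn _ j))
    (size_add_le (sz _ _) (size_scale_le _ (sz _ _))) _.
by rewrite addnC addnS ltnS leq_add2l ltnW.
Qed.

Lemma nderivn_stepanov_poly f a J A k u x :
    (k < Q)%N -> f != 0 -> f.[x] ^+ c = a ->
  f.[x] ^+ k * (@stepanov_poly f J A u)^`N(k).[x] = (stepanov_cond f a k u).[x].
Proof.
move=> kQ f0 fxc; rewrite -horner_exp -hornerM /stepanov_poly linear_sum
    mulr_sumr.
rewrite /stepanov_cond !horner_sum; apply: eq_bigr => j _ /=.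
rewrite nderivn_Xcard_expM // mulrCA nderivnD mulrDr hasse_quoE //.
rewrite -[X in _ * (_ * X^`N(_) + _)]mul1r -(expr0 f) hasse_quoE // expr0 mul1r.
by rewrite !hornerE expf_card fxc.
Qed.

(** There are about q * (t + 5) coefficients and at most 2t * (q / 2 + 7t + 5)
    linear conditions for vanishing to order 2t at all the points, so some
    nonzero auxiliary polynomial satisfies them all.  Its degree, about
    q * (t + 4) + 5q / 2, bounds 2t times the number of points. *)
Lemma stepanov_bound_nonroot0 f a t :
  not_scaled_square f -> f.[0] != 0 -> (size f <= 5)%N ->
  a != 0 -> (36 <= Q)%N -> (0 < t)%N -> (4 * t ^ 2 <= Q)%N ->
  (#|[set x | f.[x] ^+ c == a]| * t.*2 <= Q * t + 7 * Q)%N.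
Proof.
move=> nsq f00 sf a0 Q36 t0 tQ; set S := [set x | _].
have f0 : f != 0 by apply: contraNneq f00 => ->; rewrite horner0.
pose A := c.-1; pose J := (t + 5)%N; pose l := t.*2.
pose B := (A + 3 * l + J)%N.
pose phi (u : 'M[F]_(J, A) * 'M[F]_(J, A)) : 'M[F]_(l, B) :=
  \matrix_(k < l, i < B) (stepanov_cond f a k u)`_i.
(* Solving the linear system by counting: the space of coefficients has more
   elements than the space of conditions. *)
have /injectivePn[u [v uv phiE]] : ~~ injectiveb phi.
  apply/negP => /injectiveP /leq_card; rewrite card_prod !card_mx -expnD.
  rewrite leq_exp2l ?finNzRing_gt1 //; apply/negP; rewrite -ltnNge.
  rewrite /B /A /J /l; move: tQ Q36; rewrite oF; clear -t0; nia.
pose w := u - v; pose P := stepanov_poly f w.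
have w0 : w != 0 by rewrite subr_eq0.
have cond0 k : (k < l)%N -> stepanov_cond f a k w = 0.
  move=> kl; apply/polyP => i; rewrite coef0.
  have [iB|iB] := ltnP i B; last first.
    rewrite nth_default // (leq_trans (size_stepanov_cond _ _ _ _ _)) //.
    by apply: leq_trans iB; rewrite /B leq_add2r leq_add2l leq_mul2l ltnW.
  move/matrixP: phiE => /(_ (Ordinal kl) (Ordinal iB)); rewrite !mxE /=.
  by rewrite stepanov_condB coefB => ->; rewrite subrr.
have P0 : P != 0.
  apply: contraNneq w0 => P0.
  pose r (M : 'M[F]_(J, A)) j : {poly F} :=
    if insub j is Some j' then rVpoly (row j' M) else 0.
  have rE M (j : 'I_J) : r M j = rVpoly (row j M) by rewrite /r valK.
  have sr M j : (size (r M j) < c)%N.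
    rewrite /r; case: insub => [j'|]; last by rewrite size_poly0; lia.
    by apply: leq_ltn_trans (size_poly _ _) _; rewrite /A; lia.
  have ind := @stepanov_indep f (r w.1) (r w.2) J nsq f00 sf (sr _) (sr _).
  have /ind{}ind : \sum_(j < J) 'X^Q ^+ j * (r w.1 j + f ^+ c * r w.2 j) = 0.
    rewrite -[RHS]P0; apply: eq_bigr => j _; by rewrite !rE.
  have row0 M : (forall j, (j < J)%N -> r M j = 0) -> M = 0.
    move=> M0; apply/row_matrixP => j; rewrite row0.
    by apply: (can_inj rVpolyK); rewrite linear0 -rE M0.
  have pair0 (x : 'M[F]_(J, A) * 'M[F]_(J, A)) : x.1 = 0 -> x.2 = 0 -> x = 0.
    by case: x => x1 x2 /= -> ->.
  by apply/eqP/pair0; apply: row0 => j /ind[].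
have : (size (enum S) * l < size P)%N.
  apply: size_multiple_roots (enum_uniq _) _ => // x; rewrite mem_enum inE =>
      /eqP fx.
  apply: dvdp_XsubC_exp_nderivn => k kl.
  have kQ : (k < Q)%N.
    apply: leq_trans kl (leq_trans _ tQ); rewrite /l -mul2n -mulnn mulnA.
    by rewrite leq_mul2r; apply/orP; right; lia.
  have := nderivn_stepanov_poly w kQ f0 fx; rewrite cond0 // horner0 => /eqP.
  rewrite mulf_eq0 expf_eq0 => /orP[/andP[_ /eqP fx0]|/eqP //].
  by move: a0; rewrite -fx fx0 expr0n gtn_eqF ?eqxx // ltnW.
have : (size P <= Q * J.-1 + 4 * c + A + 1)%N.
  apply: leq_trans (size_sum _ _ _) _; apply/bigmax_leqP => j _.
  have sA M : (size (rVpoly (row j M : 'rV[F]_A)) <= A)%N by exact: size_poly.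
  have sX : (size ('X^Q ^+ j : {poly F}) <= (Q * J.-1).+1)%N.
    rewrite -exprM size_polyXn ltnS leq_mul2l -ltnS prednK ?ltn_ord ?orbT //.
    by rewrite /J addnS.
  have sfA : (size (f ^+ c * rVpoly (row j w.2))%R <= 4 * c + A)%N.
    exact: size_mul_le (size_exp_le c sf) (sA w.2) _.
  apply: size_mul_le sX (size_add_le (leq_trans (sA _) (leq_addl _ _)) sfA) _.
  by rewrite addSn ltnS addnA leq_addr.
rewrite -cardE /l /J /A; move: #|S| (size P) => N z; rewrite oF; nia.
Qed.

(** The condition f(0) != 0 is removed by a translation, which permutes the
    points that are counted. *)
Lemma stepanov_bound f a t : not_scaled_square f -> f != 0 -> (size f <= 5)%N ->
  a != 0 -> (36 <= Q)%N -> (0 < t)%N -> (4 * t ^ 2 <= Q)%N ->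
  (#|[set x | f.[x] ^+ c == a]| * t.*2 <= Q * t + 7 * Q)%N.
Proof.
move=> nsq f0 sf a0 Q36 t0 tQ.
have /existsP[b fb] : [exists b, f.[b] != 0].
  apply: contraT => /existsPn fz.
  have := max_poly_roots f0 _ (enum_uniq F).
  rewrite -cardE; have -> : all (root f) (enum F).
    by apply/allP => x _; have := fz x; rewrite negbK.
  by move/(_ isT); rewrite ltnNge (leq_trans sf) // (leq_trans _ Q36).
pose h := f \Po ('X + b%:P).
have shift0 (p : {poly F}) : (p \Po ('X + b%:P)) \Po ('X - b%:P) = p.
  by rewrite -comp_polyA comp_polyD comp_polyX comp_polyC subrK comp_polyXr.
have -> : [set x | f.[x] ^+ c == a] = (+%R^~ b) @: [set x | h.[x] ^+ c == a].
  apply/setP => x; apply/idP/imsetP => [|[y]]; rewrite !inE.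
    move=> fx; exists (x - b); last by rewrite subrK.
    by rewrite inE /h horner_comp !hornerE subrK.
  by move=> hy ->; move: hy; rewrite /h horner_comp !hornerE.
rewrite (card_imset _ (@addIr _ b)); apply: stepanov_bound_nonroot0 => //.
- move=> d r s d0 /(congr1 (comp_poly ('X - b%:P))).
  rewrite comp_polyM comp_polyZ !rmorphXn /= shift0 => /(nsq _ _ _ d0).
  move/(congr1 (comp_poly ('X + b%:P))); rewrite comp_poly0 -comp_polyA.
  by rewrite comp_polyB comp_polyX comp_polyC addrK comp_polyXr.
- by rewrite /h horner_comp !hornerE.
- by rewrite size_comp_poly2 ?size_XaddC.
Qed.
End Stepanov.

(** * The fibre through a point *)
Section CompanionDiscriminant.
Variable K : fieldType.
Implicit Types g h : {poly K}.

(** The Pluecker coordinates of the pencil spanned by g and h; a change of basis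
    of the pencil multiplies them all by the same constant. *)
Definition minor g h i j : K := g`_i * h`_j - g`_j * h`_i.

(** The coefficients in y of the Bezoutian
    (g(x) h(y) - g(y) h(x)) / (x - y), a quadratic polynomial in y whose roots
    are the companions of x, that is the other points of its fibre. *)
Definition bezout_coef2 g h : {poly K} :=
  Poly [:: minor g h 3 0; minor g h 3 1; minor g h 3 2].
Definition bezout_coef1 g h : {poly K} :=
  Poly [:: minor g h 2 0; minor g h 3 0 + minor g h 2 1; minor g h 3 1].
Definition bezout_coef0 g h : {poly K} :=
  Poly [:: minor g h 1 0; minor g h 2 0; minor g h 3 0].
Definition companion_disc g h : {poly K} :=
  bezout_coef1 g h ^+ 2 - 4%:R *: (bezout_coef2 g h * bezout_coef0 g h).

Lemma horner_size4 g x : (size g <= 4)%N ->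
  g.[x] = g`_0 + g`_1 * x + g`_2 * x ^+ 2 + g`_3 * x ^+ 3.
Proof.
move=> sg; rewrite (horner_coef_wide _ sg) !big_ord_recr big_ord0 /=.
by rewrite add0r expr0 mulr1 expr1.
Qed.

Lemma poly_size4 g : (size g <= 4)%N -> g = Poly [:: g`_0; g`_1; g`_2; g`_3].
Proof.
move=> sg; apply/polyP => i; rewrite coef_Poly.
by case: i => [|[|[|[|i]]]] //=; rewrite !nth_default // (leq_trans sg).
Qed.

Lemma bezoutianE g h x y : (size g <= 4)%N -> (size h <= 4)%N ->
  (x - y) * ((bezout_coef2 g h).[x] * y ^+ 2 + (bezout_coef1 g h).[x] * y +
      (bezout_coef0 g h).[x]) =
  g.[x] * h.[y] - g.[y] * h.[x].
Proof.
move=> sg sh; rewrite !(horner_size4 _ sg) !(horner_size4 _ sh) /bezout_coef2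
    /bezout_coef1 /bezout_coef0 !horner_Poly /= /minor; ring.
Qed.

(** The Bezoutian on the diagonal: a ramification point is its own companion. *)
Lemma ram_polyE g h : (size g <= 4)%N -> (size h <= 4)%N ->
  ram_poly g h =
    bezout_coef2 g h * 'X^2 + bezout_coef1 g h * 'X + bezout_coef0 g h.
Proof.
move=> sg sh; rewrite /ram_poly {1 2}(poly_size4 sg) {1 2}(poly_size4 sh).
rewrite /bezout_coef2 /bezout_coef1 /bezout_coef0 /= !cons_poly_def.
rewrite !(derivD, derivM, derivC, derivX) /minor !(polyCD, polyCN, polyCM) /=.
ring.
Qed.

(** The key computation, at the origin.  Write p, q, r for the minors (1,0),
    (2,0), (3,0): the fibre of 0 is given by X (r X^2 + q X + p), and the first
    hypothesis on minors says that the companions of 0 coincide in some y.  The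
    second one, that the discriminant vanishes to order two at 0, then reads
    r^2 y h(y) = 0 and r^2 y g(y) = 0.  As g and h have no common zero, either
    y = 0 or r = 0.  If y = 0, then p = q = 0: the origin is a triple point of
    its fibre, and a double root of the ramification polynomial.  If r = 0,
    then q = 0, and p != 0 would place y at infinity, where the same argument
    contradicts the hypothesis on g3 and h3. *)
Lemma double_root_at0 (g0 g1 g2 g3 h0 h1 h2 h3 : K) (two : 2 != 0 :> K)
    (m := fun gi gj hi hj : K => gi * hj - gj * hi) :
    (forall y, g0 + g1 * y + g2 * y ^+ 2 + g3 * y ^+ 3 = 0 ->
               h0 + h1 * y + h2 * y ^+ 2 + h3 * y ^+ 3 = 0 -> False) ->
    (g3 = 0 -> h3 = 0 -> False) ->
    m g2 g0 h2 h0 ^+ 2 - 4 * m g3 g0 h3 h0 * m g1 g0 h1 h0 = 0 ->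
    m g2 g0 h2 h0 * (m g3 g0 h3 h0 + m g2 g1 h2 h1) -
      2 * (m g3 g1 h3 h1 * m g1 g0 h1 h0 + m g3 g0 h3 h0 * m g2 g0 h2 h0) = 0 ->
  m g1 g0 h1 h0 = 0 /\ m g2 g0 h2 h0 = 0.
Proof.
rewrite {}/m => cop cop_inf.
set p := g1 * h0 - _; set q := g2 * h0 - _; set r := g3 * h0 - _.
set u := g2 * h1 - _; set v := g3 * h1 - _ => D0 D1.
have hhE : p * h3 = r * h1 - v * h0 by rewrite /p /r /v; ring.
have ggE : p * g3 = r * g1 - v * g0 by rewrite /p /r /v; ring.
have huE : u * h0 = q * h1 - p * h2 by rewrite /u /p /q; ring.
have guE : u * g0 = q * g1 - p * g2 by rewrite /u /p /q; ring.
move: p q r u v D0 D1 hhE ggE huE guE => p q r u v D0 D1 hhE ggE huE guE.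
have [r0|r0] := eqVneq r 0.
  have q0 : q = 0.
    by apply/eqP; rewrite -sqrf_eq0 -D0 r0; apply/eqP; ring.
  split=> //; apply/eqP; apply: contraT => p0; exfalso.
  have v0 : v = 0.
    apply: (mulfI p0); apply: (mulfI two); rewrite !mulr0 -[RHS]oppr0 -D1 q0 r0.
    ring.
  apply: cop_inf; apply: (mulfI p0).
    by rewrite ggE r0 v0 !mul0r subr0 mulr0.
  by rewrite hhE r0 v0 !mul0r subr0 mulr0.
pose y := - q / (2 * r).
have r2 : 2 * r != 0 by rewrite mulf_neq0.
have qE : q = - (2 * r * y) by rewrite /y; field; rewrite two r0.
have pE : p = r * y ^+ 2.
  apply: (mulfI (mulf_neq0 two r2)); rewrite [RHS](_ : _ = q ^+ 2).
    by apply/eqP; rewrite eq_sym -subr_eq0 -D0; apply/eqP; ring.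
  rewrite qE; ring.
have [y0|y0] := eqVneq y 0; first by rewrite pE qE y0; split; ring.
exfalso.
have uE : u = r - v * y.
  apply/eqP; rewrite -subr_eq0; apply/eqP; apply: (mulfI y0); apply: (mulfI r2).
  rewrite !mulr0 -[RHS]oppr0 -D1 qE pE; ring.
rewrite uE qE pE in hhE ggE huE guE.
(* e3 and e2 are the three-term relations between the minors and the
   coefficients of one of the two cubics, which exclude any other zero. *)
have fibre_y x0 x1 x2 x3 : r * y ^+ 2 * x3 = r * x1 - v * x0 ->
    (r - v * y) * x0 = - (2 * r * y) * x1 - r * y ^+ 2 * x2 ->
    x0 + x1 * y + x2 * y ^+ 2 + x3 * y ^+ 3 = 0.
  move=> e3 e2; apply: (mulfI r0); rewrite mulr0.
  have {}e2 : r * y ^+ 2 * x2 = - (2 * r * y) * x1 - (r - v * y) * x0.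
    by rewrite e2; ring.
  transitivity (r * x0 + r * x1 * y + r * y ^+ 2 * x2 + r * y ^+ 2 * x3 * y).
    by ring.
  by rewrite e2 e3; ring.
by apply: (cop y); apply: fibre_y.
Qed.

(** Reduction to the origin by expanding g and h at x: t0, ..., t3 are their
    Taylor coefficients. *)
Lemma companion_disc_double_root g h x : coprimep g h -> (size g <= 4)%N ->
    (size h <= 4)%N -> (g`_3 = 0 -> h`_3 = 0 -> False) -> 2 != 0 :> K ->
    (companion_disc g h).[x] = 0 -> (companion_disc g h)^`().[x] = 0 ->
  (ram_poly g h).[x] = 0 /\ (ram_poly g h)^`().[x] = 0.
Proof.
move=> cop sg sh top two D0 D1.
pose t0 (p : {poly K}) := p.[x].
pose t1 (p : {poly K}) := p`_1 + 2 * p`_2 * x + 3 * p`_3 * x ^+ 2.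
pose t2 (p : {poly K}) := p`_2 + 3 * p`_3 * x.
have tE (p : {poly K}) y : (size p <= 4)%N ->
    t0 p + t1 p * y + t2 p * y ^+ 2 + p`_3 * y ^+ 3 = p.[x + y].
  by move=> sp; rewrite /t0 /t1 /t2 !(horner_size4 _ sp); ring.
pose m (tg th : {poly K} -> K) := tg g * th h - th g * tg h.
pose t3 (p : {poly K}) := p`_3.
have a_x : (bezout_coef2 g h).[x] = m t3 t0.
  rewrite /m /t3 /t0 (horner_size4 _ sg) (horner_size4 _ sh) /bezout_coef2
      !hornerE /minor /=; ring.
have b_x : (bezout_coef1 g h).[x] = m t2 t0 - 2 * m t3 t0 * x.
  rewrite /m /t3 /t2 /t0 (horner_size4 _ sg) (horner_size4 _ sh) /bezout_coef1
      !hornerE /minor /=; ring.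
have c_x : (bezout_coef0 g h).[x] = m t1 t0 - m t2 t0 * x + m t3 t0 * x ^+ 2.
  rewrite /m /t3 /t2 /t1 /t0 (horner_size4 _ sg) (horner_size4 _ sh)
      /bezout_coef0 !hornerE /minor /=.
  by ring.
have a'_x : (bezout_coef2 g h)^`().[x] = m t3 t1.
  rewrite /m /t3 /t1 /bezout_coef2 /= !cons_poly_def
      !(derivD, derivM, derivC, derivX).
  by rewrite !hornerE /minor /=; ring.
have b'_x : (bezout_coef1 g h)^`().[x] = m t3 t0 + m t2 t1 - 2 * m t3 t1 * x.
  rewrite /m /t3 /t2 /t1 /t0 (horner_size4 _ sg) (horner_size4 _ sh)
      /bezout_coef1 /= !cons_poly_def.
  by rewrite !(derivD, derivM, derivC, derivX) !hornerE /minor /=; ring.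
have c'_x : (bezout_coef0 g h)^`().[x] =
    m t2 t0 - (m t3 t0 + m t2 t1) * x + m t3 t1 * x ^+ 2.
  rewrite /m /t3 /t2 /t1 /t0 (horner_size4 _ sg) (horner_size4 _ sh)
      /bezout_coef0 /= !cons_poly_def.
  by rewrite !(derivD, derivM, derivC, derivX) !hornerE /minor /=; ring.
have [] := @double_root_at0 (t0 g) (t1 g) (t2 g) g`_3 (t0 h) (t1 h) (t2 h) h`_3
    two.
- move=> y; rewrite !tE // => gy hy.
  have /coprimep_root/(_ (introT rootP gy)) := cop; by rewrite hy eqxx.
- exact: top.
- rewrite -[RHS]D0 !(hornerD, hornerN, hornerZ, hornerM, horner_exp) a_x b_x
    c_x /m /t3; ring.
- apply: (mulfI two); rewrite mulr0 -[RHS]D1.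
  rewrite /companion_disc expr2 derivB derivZ !derivM
      !(hornerD, hornerN, hornerZ, hornerM).
  by rewrite a_x b_x c_x a'_x b'_x c'_x /m /t3; ring.
rewrite -/(m t1 t0) -/(m t2 t0) => m1 m2; rewrite ram_polyE //.
rewrite !(derivD, derivM, derivXn, derivX, hornerD, hornerM, hornerXn, hornerX,
    hornerMn).
rewrite a_x b_x c_x a'_x b'_x c'_x hornerC.
by rewrite m1 m2; split; ring.
Qed.

Lemma coef3_companion_disc g h : (companion_disc g h)`_3 =
  2 * (minor g h 3 1 * (minor g h 3 0 + minor g h 2 1) -
       2 * (minor g h 3 2 * minor g h 2 0 + minor g h 3 1 * minor g h 3 0)).
Proof.
rewrite /companion_disc coefB coefZ expr2 !coefM !big_ord_recr !big_ord0 /=.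
rewrite !coef_Poly /=; ring.
Qed.

Lemma coef4_companion_disc g h : (companion_disc g h)`_4 =
  minor g h 3 1 ^+ 2 - 4 * (minor g h 3 2 * minor g h 3 0).
Proof.
rewrite /companion_disc coefB coefZ expr2 !coefM !big_ord_recr !big_ord0 /=.
rewrite !coef_Poly /=; ring.
Qed.

Lemma size_bezout_coef g h :
  [/\ (size (bezout_coef2 g h) <= 3)%N, (size (bezout_coef1 g h) <= 3)%N
    & (size (bezout_coef0 g h) <= 3)%N].
Proof. by split; apply: size_Poly. Qed.

(** A double root of the discriminant at infinity: exchange 0 and infinity by
    reversing the coefficients of g and h. *)
Lemma companion_disc_double_infty g h : coprimep g h -> (size g <= 4)%N ->
    (size h <= 4)%N -> (g`_3 = 0 -> h`_3 = 0 -> False) -> 2 != 0 :> K ->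
    (size (companion_disc g h) <= 3)%N ->
  (size (ram_poly g h) <= 3)%N.
Proof.
move=> cop sg sh top two sD.
have cD i : (2 < i)%N -> (companion_disc g h)`_i = 0.
  by move=> i3; rewrite nth_default // (leq_trans sD).
have [] := @double_root_at0 g`_3 g`_2 g`_1 g`_0 h`_3 h`_2 h`_1 h`_0 two.
- move=> y gy hy; have [y0|y0] := eqVneq y 0.
    rewrite y0 in gy hy.
    by apply: top; [rewrite -[RHS]gy | rewrite -[RHS]hy]; ring.
  have flip (p : {poly K}) : (size p <= 4)%N ->
      p`_3 + p`_2 * y + p`_1 * y ^+ 2 + p`_0 * y ^+ 3 = 0 -> root p y^-1.
    move=> sp e; apply/rootP/(mulfI (expf_neq0 3 y0)); rewrite mulr0 -[RHS]e.
    by rewrite (horner_size4 _ sp); field.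
  have /coprimep_root/(_ (flip g sg gy)) := cop.
  by move: (flip h sh hy) => /rootP ->; rewrite eqxx.
- move=> g0 h0; have : root g 0 && root h 0.
    by rewrite /root !horner_coef0 g0 h0 eqxx.
  by case/andP => /(coprimep_root cop) /negP.
- by rewrite -[RHS](cD 4%N) // coef4_companion_disc /minor; ring.
- apply: (mulfI two); rewrite mulr0 -[RHS](cD 3%N) // coef3_companion_disc.
  by rewrite /minor; ring.
move=> m23 m13.
have m0 i j : g`_i * h`_j - g`_j * h`_i = 0 -> minor g h j i = 0.
  by move=> e; rewrite /minor -[LHS]opprB e oppr0.
rewrite ram_polyE // /bezout_coef2 /bezout_coef1 /bezout_coef0 (m0 2%N 3%N) //
    (m0 1%N 3%N) //.
rewrite /= !cons_poly_def !polyC0 !(mul0r, add0r, addr0).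
apply/leq_sizeP => i i3.
rewrite !(mulrDl, coefD, coefMX, coefMXn, coefC).
by case: i i3 => [|[|[|i]]] // _; rewrite /= !(addr0, add0r, mul0r).
Qed.
End CompanionDiscriminant.

(** * Four ramification points make the discriminant separable *)
Lemma separable_companion_disc (K : closedFieldType) (g h : {poly K}) :
    coprimep g h -> (size g <= 4)%N -> (size h <= 4)%N ->
    (g`_3 = 0 -> h`_3 = 0 -> False) -> 2 != 0 :> K ->
    separable_poly (ram_poly g h) -> (3 < size (ram_poly g h))%N ->
  separable_poly (companion_disc g h) /\ (3 < size (companion_disc g h))%N.
Proof.
move=> cop sg sh top two sepW sW; split; last first.
  by rewrite ltnNge; apply: contraL sW => /companion_disc_double_infty sW;
    rewrite -leqNgt sW.
rewrite separable_poly.unlock in sepW *.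
apply/Pdiv.ClosedField.coprimepP => x /rootP D0; apply/negP => /eqP D1.
have [W0 W1] := companion_disc_double_root cop sg sh top two D0 D1.
by move/coprimep_root: sepW => /(_ _ (introT rootP W0)); rewrite W1 eqxx.
Qed.

Lemma size_companion_disc (F : fieldType) (g h : {poly F}) :
  (size (companion_disc g h) <= 5)%N.
Proof.
have [s2 s1 s0] := size_bezout_coef g h.
apply: size_add_le; first exact: (size_exp_le 2 s1).
by rewrite size_polyN; apply: size_scale_le; apply: size_mul_le s2 s0 _.
Qed.

Lemma size_ram_poly (F : fieldType) (g h : {poly F}) :
  (size g <= 4)%N -> (size h <= 4)%N -> (size (ram_poly g h) <= 5)%N.
Proof.
move=> sg sh; have [s2 s1 s0] := size_bezout_coef g h; rewrite ram_polyE //.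
apply: size_add_le; last exact: leq_trans s0 _.
apply: size_add_le; last by apply: size_mul_le s1 (eq_leq (size_polyX _)) _.
by apply: size_mul_le s2 (eq_leq (size_polyXn _ 2)) _.
Qed.

Lemma closed_notin (K : closedFieldType) (s : seq K) : exists x, x \notin s.
Proof.
have /closed_nonrootP[x] := monic_neq0 (monic_prod_XsubC s xpredT id).
by rewrite root_prod_XsubC; exists x.
Qed.

Lemma cubic_ratexprP (F : fieldType) (g h : {poly F}) : cubic_ratexpr g h ->
  [/\ coprimep g h, (size g <= 4)%N, (size h <= 4)%N
    & g`_3 = 0 -> h`_3 = 0 -> False].
Proof.
move=> /andP[cop /eqP]; rewrite /ratdeg => deg3.
have lead_n0 (p : {poly F}) : size p = 4 -> p`_3 = 0 -> False.
  move=> p4 p3; have /eqP : lead_coef p = 0 by rewrite /lead_coef p4.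
  by rewrite lead_coef_eq0 => /eqP p0; rewrite p0 size_poly0 in p4.
split=> //; [lia|lia|move=> g3 h3].
have [/lead_n0/(_ g3)//|/lead_n0/(_ h3)//] : size g = 4 \/ size h = 4 by lia.
Qed.

(** The ramification polynomial is a binary form of degree four; four distinct
    zeros on the projective line leave no room for a multiple one. *)
Lemma separable_ram_poly (F : fieldType) (K : closedFieldType)
    (iota : {rmorphism F -> K}) (g h : {poly F}) :
    cubic_ratexpr g h -> has_nb_ram_points iota g h 4 ->
  separable_poly (ram_poly g h) /\ (3 < size (ram_poly g h))%N.
Proof.
move=> cub; have [cop sg sh _] := cubic_ratexprP cub; move: cub.
move=> /andP[_ /eqP deg3] [s [us s4 sE]].
set W := ram_poly g h in sE *; pose WK := map_poly iota W.
pose A := pmap id s.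
have memA x : (x \in A) = root WK x.
  have -> : (x \in A) = (Some x \in s) by rewrite mem_pmap map_id.
  by rewrite sE.
have uA : uniq A by apply: pmap_uniq us => -[x|] //.
have sA : (size A + (None \in s) = 4)%N.
  rewrite -s4 size_pmap -(count_predC isSome s) -(count_uniq_mem _ us).
  by congr (_ + _)%N; apply: eq_count => -[].
have W0 : W != 0.
  apply: contraTneq isT => W0; have [x] := closed_notin A.
  by rewrite memA /WK W0 rmorph0 root0.
have sWK : size WK = size W by rewrite size_map_poly.
have sW : size W = (size A).+1.
  have : (size A < size W)%N.
    by rewrite -sWK; apply: max_poly_roots; rewrite ?map_poly_eq0 //;
      apply/allP => x; rewrite memA.
  have : (size W <= 5)%N by apply: size_ram_poly.
  have : None \in s -> (size W <= 4)%N by rewrite sE /= deg3.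
  by case: (None \in s) sA => sA; [move/(_ isT)|]; lia.
split; last by rewrite sW; case: (None \in s) sA; lia.
rewrite -(separable_map iota) -/WK.
have WE : WK = lead_coef WK *: \prod_(x <- A) ('X - x%:P).
  apply: all_roots_prod_XsubC; rewrite ?sWK ?uniq_rootsE //.
  by apply/allP => x; rewrite memA.
rewrite WE (eqp_separable (eqp_scale _ _)) ?separable_prod_XsubC //.
by rewrite lead_coef_eq0 map_poly_eq0.
Qed.

(** In characteristic two, second derivatives vanish, so that the ramification
    polynomial has derivative zero. *)
Lemma two_neq0_separable_ram (F : fieldType) (g h : {poly F}) :
  separable_poly (ram_poly g h) -> (3 < size (ram_poly g h))%N -> 2 != 0 :> F.
Proof.
rewrite separable_poly.unlock => sepW sW; apply/eqP => two.
have d2 (p : {poly F}) : p^`()^`() = 0.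
  rewrite -[LHS]/(p^`(2)) nderivn_def -mulr_natr -[2%:R]polyC_natr two.
  by rewrite mulr0.
move: sepW; rewrite {2}/ram_poly derivB !derivM !d2 mul0r mulr0 add0r addr0 subrr.
by rewrite coprimep0 -size_poly_eq1 => /eqP W1; rewrite W1 in sW.
Qed.

(** What remains of the hypothesis on ramification points, in a form that only
    refers to the base field and is stable under extension. *)
Definition generic_ratexpr (F : fieldType) (g h : {poly F}) :=
  [/\ 2 != 0 :> F, ram_poly g h != 0, separable_poly (companion_disc g h)
    & (3 < size (companion_disc g h))%N].

Lemma map_companion_disc (F K : fieldType) (iota : {rmorphism F -> K}) g h :
  map_poly iota (companion_disc g h) =
    companion_disc (map_poly iota g) (map_poly iota h).
Proof.
have mE i j : iota (minor g h i j) = minor (map_poly iota g) (map_poly iota h)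
    i j.
  by rewrite /minor !coef_map rmorphB !rmorphM.
have map3 x y z : map_poly iota (Poly [:: x; y; z]) =
    Poly [:: iota x; iota y; iota z] by rewrite map_Poly.
rewrite /companion_disc rmorphB rmorphXn /= map_polyZ [map_poly _ (_ * _)]rmorphM.
by rewrite rmorph_nat /= !map3 [iota (minor _ _ 3 0 + _)]rmorphD !mE.
Qed.

Lemma map_ram_poly (F K : fieldType) (iota : {rmorphism F -> K}) g h :
  map_poly iota (ram_poly g h) = ram_poly (map_poly iota g) (map_poly iota h).
Proof. by rewrite /ram_poly rmorphB !rmorphM /= !deriv_map. Qed.

Lemma generic_ratexpr_ram4 (F : fieldType) (K : closedFieldType)
    (iota : {rmorphism F -> K}) (g h : {poly F}) :
  cubic_ratexpr g h -> has_nb_ram_points iota g h 4 -> generic_ratexpr g h.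
Proof.
move=> cub ram; have [sepW sW] := separable_ram_poly cub ram.
have two := two_neq0_separable_ram sepW sW; rewrite /generic_ratexpr two
    (separable_poly_neq0 sepW).
have [cop sg sh top] := cubic_ratexprP cub.
have := @separable_companion_disc K (map_poly iota g) (map_poly iota h).
rewrite -map_companion_disc -map_ram_poly !separable_map !size_map_poly
    coprimep_map.
rewrite !coef_map; case=> //.
- move=> /eqP; rewrite fmorph_eq0 => /eqP g3 /eqP; rewrite fmorph_eq0 => /eqP h3.
  exact: top.
- by rewrite -(rmorph_nat iota) fmorph_eq0.
Qed.

(** * Squares and quadratic equations in a finite field *)

(** After division by the greatest common divisor, r ^+ 2 * f = b *: s ^+ 2
    forces s ^+ 2 to divide f, hence s and then f to be constant. *)
Lemma separable_not_scaled_square (F : fieldType) (f : {poly F}) :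
  separable_poly f -> (1 < size f)%N -> not_scaled_square f.
Proof.
move=> sepf sf b r s b0 E; apply: contraTeq sf => r0; rewrite -leqNgt.
pose d := gcdp r s; have d0 : d != 0 by rewrite gcdp_eq0 negb_and r0.
have rE : r = r %/ d * d by rewrite divpK ?dvdp_gcdl.
have sE : s = s %/ d * d by rewrite divpK ?dvdp_gcdr.
have cop : coprimep (r %/ d) (s %/ d).
  by rewrite coprimep_div_gcd // r0.
move: (r %/ d) (s %/ d) rE sE cop => u v rE sE cop.
have {}E : u ^+ 2 * f = b *: v ^+ 2.
  apply: (mulIf (expf_neq0 2 d0)); move: E; rewrite rE sE !exprMn => E.
  by rewrite mulrAC E scalerAl.
have dv : v ^+ 2 %| f.
  rewrite -(Gauss_dvdpr _ (_ : coprimep (v ^+ 2) (u ^+ 2))).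
    by rewrite E -mul_polyC dvdp_mull.
  by rewrite coprimep_expl // coprimep_expr // coprimep_sym.
have v1 : size v = 1%N.
  by apply/eqP; apply: contraTT dv => v1; rewrite (separable_nosquare sepf).
have u0 : u != 0 by apply: contraNneq r0 => u0; rewrite rE u0 mul0r.
have : size (u ^+ 2 * f) = 1%N.
  rewrite E size_scale //; have /eqP/size_poly1P[a a0 ->] := v1.
  by rewrite -polyC_exp size_polyC expf_neq0.
by move/eqP; rewrite size_mul_eq1 => /andP[_ /eqP->].
Qed.

Lemma card_roots_le (F : finFieldType) (p : {poly F}) :
  p != 0 -> (#|[set x | root p x]| < size p)%N.
Proof.
move=> p0; rewrite cardE; apply: max_poly_roots => //; last exact: enum_uniq.
by apply/allP => x; rewrite mem_enum inE.
Qed.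

Section FiniteFieldSquares.
Variables (F : finFieldType) (c : nat).
Hypothesis oF : #|F| = c.*2.+1.

Lemma exp_half (u : F) : u != 0 -> u ^+ c = 1 \/ u ^+ c = -1.
Proof.
move=> u0; have : (u ^+ c) ^+ 2 == 1.
  rewrite -exprM muln2; apply/eqP/(mulfI u0).
  by rewrite -exprS -oF expf_card mulr1.
by rewrite sqrf_eq1 => /orP[/eqP|/eqP]; [left|right].
Qed.

Lemma exp_half_square (z : F) : z != 0 -> (z ^+ 2) ^+ c = 1.
Proof.
move=> z0; apply: (mulfI z0); rewrite -exprM mul2n -exprS -oF.
by rewrite expf_card mulr1.
Qed.

(** Squaring is at most two-to-one, so there are at least c nonzero squares, and
    'X^c - 1 has at most c roots. *)
Lemma euler_square (u : F) : u ^+ c = 1 -> exists z, u = z ^+ 2.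
Proof.
move=> uc; pose T := [set z ^+ 2 | z in [set z : F | z != 0]].
pose E := [set u : F | root ('X^c - 1%:P) u].
have c0 : (0 < c)%N by have := finNzRing_gt1 F; rewrite oF; case: (c).
have sTE : T \subset E.
  apply/subsetP => _ /imsetP[z z0 ->]; rewrite inE in z0.
  by rewrite inE /root !hornerE exp_half_square // subrr.
have cE : (#|E| <= c)%N.
  have := @card_roots_le F ('X^c - 1%:P); rewrite size_XnsubC // ltnS; apply.
  by rewrite monic_neq0 // monicXnsubC.
have cT : (c <= #|T|)%N.
  have : (c.*2 <= \sum_(v in T) 2)%N.
    have -> : c.*2 = #|[set z : F | z != 0]|.
      have := cardC1 (0 : F); rewrite oF /= => <-.
      by apply: eq_card => z; rewrite !inE.
    rewrite -sum1_card (partition_big_imset (fun z => z ^+ 2)) /=.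
    apply: leq_sum => v _; rewrite sum1_card.
    have [z /andP[_ /eqP zv]|none] :=
      pickP [pred z | (z \in [set z : F | z != 0]) && (z ^+ 2 == v)]; last first.
      by rewrite eq_card0.
    apply: leq_trans (_ : #|[set z; - z]| <= 2)%N; last by rewrite cards2;
        case: eqP.
    apply: subset_leq_card; apply/subsetP => y; rewrite unfold_in /= -zv =>
        /andP[_].
    by rewrite eqf_sqr !inE.
  by rewrite sum_nat_const muln2 leq_double.
have : u \in T.
  have /eqP -> : T == E by rewrite eqEcard sTE (leq_trans cE).
  by rewrite inE /root !hornerE uc subrr.
by case/imsetP => z _ ->; exists z.
Qed.

Lemma card_quadratic_square (a b e z : F) : 2 != 0 :> F -> a != 0 ->
  b ^+ 2 - 4 * (a * e) = z ^+ 2 -> z != 0 ->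
  #|[set y | a * y ^+ 2 + b * y + e == 0]| = 2.
Proof.
move=> two a0 D z0; have a2 : 2 * a != 0 by rewrite mulf_neq0.
have -> : [set y | a * y ^+ 2 + b * y + e == 0] =
    [set (- b + z) / (2 * a); (- b - z) / (2 * a)].
  apply/setP => y; rewrite !inE.
  have e4 : 4 * a * (a * y ^+ 2 + b * y + e) =
      (2 * a * y - (- b + z)) * (2 * a * y - (- b - z)).
    transitivity ((2 * a * y + b) ^+ 2 - z ^+ 2); last by ring.
    by rewrite -D; ring.
  have a4 : 4 * a != 0 by rewrite (_ : 4 * a = 2 * (2 * a)) ?mulf_neq0 //; ring.
  rewrite -[LHS]orFb -(negPf a4) -mulf_eq0 e4 mulf_eq0 !subr_eq0.
  by rewrite ![2 * a * y]mulrC !(can2_eq (mulfK a2) (divfK a2)).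
rewrite cards2; case: eqP => // /(mulIf (invr_neq0 a2)) /addrI /eqP.
by rewrite -subr_eq0 opprK -mulr2n -[z *+ 2]mulr_natl mulf_eq0 (negPf two)
    (negPf z0).
Qed.

Lemma card_quadratic_nonsquare (a b e : F) : 2 != 0 :> F ->
  (forall z, b ^+ 2 - 4 * (a * e) != z ^+ 2) ->
  #|[set y | a * y ^+ 2 + b * y + e == 0]| = 0.
Proof.
move=> two nsq; apply/eqP; rewrite cards_eq0; apply/eqP/setP => y; rewrite !inE.
apply/negbTE/negP => /eqP e0; have /negP := nsq (2 * a * y + b); apply.
apply/eqP; transitivity (b ^+ 2 - 4 * a * e + 4 * a * (a * y ^+ 2 + b * y + e)).
  by rewrite e0; ring.
by ring.
Qed.
End FiniteFieldSquares.

(** * The image of a cubic rational function over a finite field *)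

(** Each point of an image is the sum of 1/m over its m preimages; the factor 6
    clears the denominators 1, 2 and 3. *)
Lemma card_imset_fibres (T T' : finType) (V : {set T}) (f : T -> T')
    (m := fun x => #|[set y in V | f y == f x]|) :
  (forall x, m x <= 3)%N -> (6 * #|f @: V| = \sum_(x in V) 6 %/ m x)%N.
Proof.
move=> m3; rewrite mulnC -sum_nat_const (partition_big_imset f) /=.
apply: eq_bigr => a /imsetP[x xV ->].
rewrite (eq_bigr (fun=> 6 %/ m x)%N); last first.
  move=> y /andP[_ /eqP fxy]; congr (_ %/ _)%N.
  by apply: eq_card => z; rewrite !inE fxy.
rewrite sum_nat_const; set k := #|_|.
have -> : k = m x by apply: eq_card => y; rewrite !inE.
have : (0 < m x)%N by apply/card_gt0P; exists x; rewrite !inE xV eqxx.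
by case: (m x) (m3 x) => [|[|[|[]]]].
Qed.

Section Fibres.
Variables (F : finFieldType) (c : nat) (g h : {poly F}).
Hypotheses (oF : #|F| = c.*2.+1) (cub : cubic_ratexpr g h)
    (good : generic_ratexpr g h).
Local Notation D := (companion_disc g h).

Definition ratdom := [set x : F | h.[x] != 0].
Definition ratfun x := g.[x] / h.[x].
Definition ratimg := ratfun @: ratdom.
Definition fibre x := [set y in ratdom | ratfun y == ratfun x].

Lemma root_ratfun (x a : F) : (g.[x] = a * h.[x]) <->
    (x \in ratdom /\ ratfun x = a).
Proof.
have [cop _ _ _] := cubic_ratexprP cub; rewrite inE /ratfun; split=> [e|[h0 <-]].
  have h0 : h.[x] != 0.
    have [gx|gx] := eqVneq g.[x] 0; first exact:
        (coprimep_root cop (introT rootP gx)).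
    by apply: contraNneq gx => h0; rewrite e h0 mulr0.
  by rewrite h0 e mulfK.
by rewrite divfK.
Qed.

Lemma fibreE x : x \in ratdom ->
  fibre x = [set y | g.[y] * h.[x] == g.[x] * h.[y]].
Proof.
rewrite inE => hx; apply/setP => y; rewrite !inE.
apply/andP/eqP => [[hy /eqP]|e].
  rewrite /ratfun => /eqP; rewrite eqr_div // => /eqP ->.
  by [].
have := (root_ratfun y (ratfun x)).1; rewrite inE => -[|-> ->] //.
apply: (mulIf hx); rewrite e /ratfun; by field.
Qed.

Lemma card_fibre_le3 x : (#|fibre x| <= 3)%N.
Proof.
have [cop sg sh top] := cubic_ratexprP cub.
pose a := ratfun x; pose p := g - a *: h.
have p0 : p != 0.
  apply/eqP => /subr0_eq ga; have hg : h %| g by rewrite ga -mul_polyC dvdp_mull.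
  have /coprimepP/(_ h hg) := cop; move=> /(_ (dvdpp h)); rewrite
      -size_poly_eq1 => /eqP h1.
  have h3 : h`_3 = 0 by rewrite nth_default ?h1.
  by apply: top => //; rewrite ga coefZ h3 mulr0.
have -> : fibre x = [set y | root p y].
  apply/setP => y; rewrite !inE /root !hornerE subr_eq0.
  apply/andP/eqP => [[hy /eqP e]|/root_ratfun].
    by apply/root_ratfun; rewrite inE.
  by rewrite inE => -[-> ->].
rewrite -ltnS (leq_trans (card_roots_le p0)) //.
by apply: size_add_le; rewrite ?size_polyN ?size_scale_le.
Qed.

(** The points whose fibre consists of the point and of the roots of a quadratic
    equation with nonzero discriminant that the point does not satisfy. *)
Definition good_pts :=
  [set x | [&& h.[x] != 0, (bezout_coef2 g h).[x] != 0, D.[x] != 0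
             & (ram_poly g h).[x] != 0]].

Lemma fibre_good x : x \in good_pts ->
  let E := [set y | (bezout_coef2 g h).[x] * y ^+ 2 + (bezout_coef1 g h).[x] * y
                    + (bezout_coef0 g h).[x] == 0] in
  fibre x = x |: E /\ x \notin E.
Proof.
have [cop sg sh top] := cubic_ratexprP cub.
rewrite inE => /and4P[hx ax Dx Wx] E; split; last first.
  rewrite inE; move: Wx; rewrite ram_polyE //.
  by rewrite !(hornerD, hornerM, hornerXn, hornerX).
rewrite fibreE ?inE //; apply/setP => y; rewrite !inE.
rewrite -subr_eq0 -oppr_eq0 opprB -bezoutianE // mulf_eq0 subr_eq0.
by rewrite [x == y]eq_sym.
Qed.

Lemma companion_discE x : D.[x] =
  (bezout_coef1 g h).[x] ^+ 2
    - 4 * ((bezout_coef2 g h).[x] * (bezout_coef0 g h).[x]).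
Proof.
by rewrite /companion_disc !(hornerD, hornerN, hornerZ, hornerM, horner_exp).
Qed.

Lemma card_fibre_square x : x \in good_pts -> D.[x] ^+ c = 1 -> #|fibre x| = 3.
Proof.
move=> xg Dc; have [-> xN] := fibre_good xg; rewrite cardsU1 xN add1n; congr _.+1.
move: xg; rewrite inE => /and4P[hx ax Dx Wx]; have [two _ _ _] := good.
have [z Dz] := euler_square oF Dc.
apply: (card_quadratic_square (z := z)) => //; first by rewrite -companion_discE.
by apply: contraNneq Dx => z0; rewrite Dz z0 expr0n.
Qed.

Lemma card_fibre_nonsquare x :
  x \in good_pts -> D.[x] ^+ c = -1 -> #|fibre x| = 1%N.
Proof.
move=> xg Dc; have [-> xN] := fibre_good xg; rewrite cardsU1 xN add1n; congr _.+1.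
move: xg; rewrite inE => /and4P[hx ax Dx Wx]; have [two _ _ _] := good.
apply: card_quadratic_nonsquare => // z; rewrite -companion_discE.
apply: contraNneq two => Dz; have z0 : z != 0.
  by apply: contraNneq Dx => z0; rewrite Dz z0 expr0n.
have e : -1 = 1 :> F by rewrite -Dc Dz (exp_half_square oF).
by rewrite (_ : 2 = 1 + 1) // -{1}e addNr.
Qed.

Lemma card_bad_pts : (#|~: good_pts| <= 13)%N.
Proof.
have [cop sg sh top] := cubic_ratexprP cub; have [two W0 sepD sD] := good.
have h0 : h != 0.
  by apply: contraNneq W0 => ->; rewrite /ram_poly mulr0 deriv0 mulr0 subrr.
have a0 : bezout_coef2 g h != 0.
  apply: contraTneq sD => a0; rewrite -leqNgt.
  have m0 i : (i < 3)%N -> minor g h 3 i = 0.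
    move=> i3; have := congr1 (fun p : {poly F} => p`_i) a0.
    by rewrite /bezout_coef2 coef_Poly coef0; case: i i3 => [|[|[]]].
  rewrite /companion_disc a0 mul0r scaler0 subr0 /bezout_coef1 !m0 //.
  have s2 : (size (Poly [:: minor g h 2 0; 0 + minor g h 2 1; 0])%R <= 2)%N.
    apply/leq_sizeP => i i2; rewrite coef_Poly.
    by case: i i2 => [|[|[|i]]] //= _; rewrite nth_nil.
  exact: size_exp_le s2.
have bnd (p : {poly F}) k : p != 0 -> (size p <= k.+1)%N ->
    (#|[set x | root p x]| <= k)%N.
  by move=> p0 sp; rewrite -ltnS (leq_trans (card_roots_le p0)).
have [s2 _ _] := size_bezout_coef g h.
have D5 := size_companion_disc g h.
have -> : ~: good_pts = [set x | root h x] :|: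
    [set x | root (bezout_coef2 g h) x] :|:
   ([set x | root D x] :|: [set x | root (ram_poly g h) x]).
  by apply/setP => x; rewrite !inE /root !negb_and !negbK -!orbA.
apply: leq_trans (leq_card_setU _ _).1 _.
apply: (@leq_trans (5 + 8)) => //; apply: leq_add.
  by apply: leq_trans (leq_card_setU _ _).1 _; apply: (@leq_add _ _ 3 2);
      apply: bnd.
apply: leq_trans (leq_card_setU _ _).1 _; apply: (@leq_add _ _ 4 4); apply: bnd
    => //.
  exact: separable_poly_neq0.
exact: size_ram_poly.
Qed.
End Fibres.

Lemma odd_card_finField (F : finFieldType) : 2 != 0 :> F ->
  exists c, #|F| = c.*2.+1.
Proof.
move=> two; exists #|F|./2; rewrite -[LHS]odd_double_half.
suff -> : odd #|F| by [].
apply: contraR two => ev; suff : (2 : nat) \in [pchar F].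
  by move=> /pcharf0 ->.
apply: (pnatPpi (finField_card_pnat F)); rewrite mem_primes /=.
by rewrite dvdn2 ev andbT ltnW ?finNzRing_gt1.
Qed.

Lemma sqrt_half_floor Q : exists t, (4 * t ^ 2 <= Q < 4 * t.+1 ^ 2)%N.
Proof.
elim: Q => [|Q [t /andP[tQ Qt]]]; first by exists 0%N.
have [Q1|Q1] := leqP (4 * t.+1 ^ 2) Q.+1; last by exists t; rewrite leqW.
exists t.+1; rewrite Q1 (leq_ltn_trans Qt) // ltn_pmul2l // ltn_exp2r //.
Qed.

Section ImageCount.
Variables (F : finFieldType) (g h : {poly F}).
Hypotheses (cub : cubic_ratexpr g h) (good : generic_ratexpr g h).

(** Up to a bounded number of points, a fibre has three points where the
    companion discriminant is a nonzero square and one point where it is not a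
    square.  By Stepanov's bound, applied to both values a = 1 and a = -1, each
    case occurs for about half of the points, and the image has about
    (q / 2) / 3 + q / 2 = 2q / 3 elements. *)
Lemma card_ratimgC (R : realFieldType) (s : R) :
  0 <= s -> s ^+ 2 = #|F|%:R ->
  `|3 * #|~: ratimg g h|%:R - #|F|%:R| <= 35 * s.
Proof.
move=> s0 sE; set Q := #|F|.
have [two W0 sepD sD] := good; have [c oF] := odd_card_finField two.
have imQ : (#|ratimg g h| + #|~: ratimg g h| = Q)%N by rewrite cardsC.
set m := #|ratimg g h| in imQ; set k := #|~: _| in imQ *.
have mkQ : m%:R + k%:R = Q%:R :> R by rewrite -natrD imQ.
have kpos : 0 <= k%:R :> R := ler0n _ _; have mpos : 0 <= m%:R :> R := ler0n _ _.
(* Stepanov's bound needs q to be large; below 36 the error term exceeds the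
   trivial bound. *)
have [Qs|Q36] := ltnP Q 36.
  have s6 : s <= 6.
    rewrite leNgt; apply/negP => s6; have : s ^+ 2 < 36 by rewrite sE
        (ltr_nat R Q 36).
    by nra.
  have sQ : Q%:R <= 6 * s by rewrite -sE expr2; nra.
  rewrite ler_norml; apply/andP; split; lra.
have s6 : 6 <= s.
  have : 36 <= s ^+ 2 by rewrite sE (ler_nat R 36 Q).
  by nra.
pose S a := [set x in good_pts g h | (companion_disc g h).[x] ^+ c == a].
(* Stepanov's bound reads 2 t N <= Q t + 7 Q, where Q = s ^+ 2 and s <= 4 t. *)
have Sbd a : a != 0 -> #|S a|%:R <= Q%:R / 2 + 14 * s.
  move=> a0; have [t /andP[tQ Qt]] := sqrt_half_floor Q.
  have c1 : (1 < c)%N by move: Q36; rewrite /Q oF; lia.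
  have t0 : (0 < t)%N by case: (t) Qt Q36 => // ; lia.
  have nsq : not_scaled_square (companion_disc g h).
    by apply: separable_not_scaled_square => //; apply: ltn_trans sD.
  have D5 := size_companion_disc g h.
  have := stepanov_bound oF c1 nsq (separable_poly_neq0 sepD) D5 a0 Q36 t0 tQ.
  have : (#|S a| <= #|[set x | (companion_disc g h).[x] ^+ c == a]|)%N.
    by apply/subset_leq_card/subsetP => x; rewrite !inE => /andP[].
  move: #|S a| #|[set x | _]| => u v uv vbd.
  have st : s <= 4 * t%:R.
    have : s ^+ 2 < 4 * (t%:R + 1) ^+ 2.
      by rewrite sE natr1 -natrX -natrM ltr_nat.
    have : 1 <= t%:R :> R by rewrite ler1n.
    by nra.
  have : u%:R * (2 * t%:R) <= Q%:R * t%:R + 7 * Q%:R :> R.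
    rewrite -!natrM -natrD ler_nat mul2n (leq_trans _ vbd) //.
    by rewrite leq_mul2r uv orbT.
  rewrite -sE => ub.
  have tp : 0 < t%:R :> R by rewrite ltr0n.
  rewrite -(ler_pM2r tp); nra.
have S1 := Sbd 1 (oner_neq0 _).
have S2 : #|S (-1)|%:R <= Q%:R / 2 + 14 * s by apply: Sbd; rewrite oppr_eq0
    oner_neq0.
have e1 : good_pts g h :&: S 1 = S 1 by apply/setIidPr/subsetP => x /setIdP[].
have e2 : good_pts g h :\: S 1 = S (-1).
  apply/setP => x; rewrite in_setD [x \in S 1]inE [x \in S (-1)]inE andbC.
  case xg : (x \in good_pts g h) => //=.
  have Dx : (companion_disc g h).[x] != 0 by move: xg; rewrite inE => /and4P[].
  have [->|->] := exp_half oF Dx; rewrite eqxx // -?[_ == 1]eqr_opp ?opprK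
      -addr_eq0.
    by rewrite (negPf two).
  by rewrite (negPf two).
have n1n2 : (#|S 1%R| + #|S (-1)%R| + #|~: good_pts g h| = Q)%N.
  by rewrite -[RHS](cardsC (good_pts g h)) -(cardsID (S 1) (good_pts g h)) e1 e2.
have bad := card_bad_pts cub good.
have [lo hi] : (2 * #|S 1%R| + 6 * #|S (-1)%R| <= 6 * m)%N /\
     (6 * m <= 2 * #|S 1%R| + 6 * #|S (-1)%R| + 6 * #|~: good_pts g h|)%N.
  pose w x := (6 %/ #|fibre g h x|)%N.
  have -> : (6 * m = \sum_(x in ratdom h) w x)%N.
    exact: card_imset_fibres (card_fibre_le3 cub).
  have w1 x : x \in S 1 -> w x = 2%N.
    by rewrite inE => /andP[xg /eqP xc]; rewrite /w (card_fibre_square oF).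
  have w2 x : x \in S (-1) -> w x = 6%N.
    by rewrite inE => /andP[xg /eqP xc]; rewrite /w (card_fibre_nonsquare oF).
  have w6 x : (w x <= 6)%N by exact: leq_div.
  have sumS1 : (\sum_(x in S 1%R) w x = 2 * #|S 1%R|)%N.
    by rewrite (eq_bigr _ w1) sum_nat_const mulnC.
  have sumS2 : (\sum_(x in S (-1)%R) w x = 6 * #|S (-1)%R|)%N.
    by rewrite (eq_bigr _ w2) sum_nat_const mulnC.
  have sdom : good_pts g h \subset ratdom h.
    by apply/subsetP => x; rewrite !inE => /and4P[].
  rewrite (big_setID (good_pts g h)) /= (setIidPr sdom) (big_setID (S 1)) /= e1
      e2.
  rewrite sumS1 sumS2 leq_addr leq_add2l; split=> //.
  apply: (@leq_trans (\sum_(x in ratdom h :\: good_pts g h) 6)%N).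
    by apply: leq_sum => x _; exact: w6.
  rewrite sum_nat_const mulnC leq_mul2l subset_leq_card //.
  by apply/subsetP => x; rewrite !inE => /andP[].
move: lo; rewrite -(ler_nat R) natrD !natrM => lo.
move: hi; rewrite -(ler_nat R) 2!natrD !natrM => hi; move: lo hi.
move: n1n2 => /(congr1 (fun i => i%:R : R)); rewrite 2!natrD.
move: bad; rewrite -(ler_nat R).
move: #|S 1%R|%:R #|S (-1)%R|%:R #|~: good_pts g h|%:R S1 S2 => n1 n2 nb.
move=> S1 S2 bad n12 lo hi.
rewrite ler_norml; apply/andP; split; lra.
Qed.
End ImageCount.

(** * Minimal polynomials and finite extensions *)
Lemma irreducible_factor (F : finFieldType) (u : {poly F}) : (1 < size u)%N ->
  exists2 r, irreducible_poly r & r %| u.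
Proof.
have [m] := ubnP (size u); elim: m u => // m IHm u um u1.
have [/irreducibleP irr|] := boolP (irreducibleb u); first by exists u.
rewrite /irreducibleb u1 => /forallPn[v]; rewrite negb_imply -ltnNge.
rewrite -Pdiv.Idomain.dvdpE => /andP[vu v1].
have vm : (size v < m)%N.
  by rewrite (leq_ltn_trans (size_npoly v)) // -ltnS prednK // ltnW.
by have [r irr rv] := IHm v vm v1; exists r => //; apply: dvdp_trans vu.
Qed.

Section MinimalPolynomials.
Variables (F : fieldType) (L : fieldExtType F).
Local Notation "p ^%:A" := (map_poly (in_alg L) p)
  (at level 2, format "p ^%:A") : ring_scope.
Implicit Types (p q : {poly F}) (x : L).

Lemma minPoly_base x : exists2 p, p^%:A = minPoly 1 x & irreducible_poly p.
Proof.
have /polyOver1P[p pE] := minPolyOver 1 x; exists p => //.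
have sp : size p = (adjoin_degree 1 x).+1 by rewrite
    -(size_map_poly (in_alg L)) -pE size_minPoly.
split=> [|q q1 qp]; first by rewrite sp.
have /minPoly_irr : q^%:A \is a polyOver 1%VS by apply/polyOver1P; exists q.
move=> /(_ x); rewrite pE dvdp_map => /(_ qp) /orP[]; first by rewrite eqp_map.
by move/eqp_size; rewrite size_map_poly size_poly1 => /eqP; rewrite (negPf q1).
Qed.

Lemma root_irreducible p q x : irreducible_poly p -> root p^%:A x ->
  root q^%:A x = (p %| q).
Proof.
move=> [p1 irr] px; have [m mE [m1 _]] := minPoly_base x.
have rootE r : root r^%:A x = (m %| r).
  rewrite -(dvdp_map (in_alg L)) mE; apply/idP/idP => [rx|].
    by apply: minPoly_dvdp => //; apply/polyOver1P; exists r.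
  by move/dvdpP => [s ->]; rewrite rootM root_minPoly orbT.
move: px; rewrite !rootE => /irr mp; apply: eqp_dvdl; apply: mp.
by rewrite neq_ltn m1 orbT.
Qed.

Lemma dim_adjoin_irreducible p x : irreducible_poly p -> root p^%:A x ->
  \dim <<1; x>> = (size p).-1.
Proof.
move=> irr px; have [m mE irrm] := minPoly_base x.
have mp : m %= p.
  have mx : root m^%:A x by rewrite mE root_minPoly.
  by rewrite /eqp -(root_irreducible _ irrm mx) px -(root_irreducible _ irr px)
      mx.
rewrite dim_Fadjoin dimv1 muln1 -(eqp_size mp) -(size_map_poly (in_alg L)) mE.
by rewrite size_minPoly.
Qed.

End MinimalPolynomials.

Lemma card_finite_extension (F : finFieldType) (L : fieldExtType F) :
  #|FinFieldExtType L| = (#|F| ^ \dim {:L})%N.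
Proof.
have <- := @card_vspace F (finvect_type L) _ {:L}%VS.
by apply: eq_card => x; rewrite memvf.
Qed.

(** The splitting field of 'X^(q^n) - 'X: its roots form the fixed field of the
    n-th power of the Frobenius automorphism, hence the whole field, and they
    are distinct because the derivative of that polynomial is -1. *)
Lemma finite_extension (F : finFieldType) n : (0 < n)%N ->
  {L : fieldExtType F | \dim {:L} = n}.
Proof.
move=> n0; set m := (#|F| ^ n)%N.
have q1 := finNzRing_gt1 F; have m1 : (1 < m)%N by rewrite -(expn0 #|F|)
    ltn_exp2l.
pose q (R : nzRingType) : {poly R} := 'X^m - 'X.
have q0 : q F != 0.
  by rewrite -size_poly_gt0 size_polyDl size_polyXn // size_polyN size_polyX.
have [/= L splitL] := FinSplittingFieldFor q0; exists L.
have [zs Dq defL] := splitL.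
have {}Dq : q L %= \prod_(z <- zs) ('X - z%:P).
  by move: Dq; rewrite rmorphB /= map_polyXn map_polyX.
have Uzs : uniq zs.
  rewrite -separable_prod_XsubC -(eqp_separable Dq) separable_poly.unlock.
  have mL : m%:R = 0 :> L.
    rewrite -(rmorph_nat (in_alg L)) /m natrX.
    have -> : #|F|%:R = 0 :> F; last by rewrite expr0n gtn_eqF ?rmorph0.
    have [p _ pc] := finPcharP F; rewrite (card_pprimeChar pc) natrX pcharf0 //.
    by rewrite expr0n; case: logn (card_pprimeChar pc) q1 => // ->.
  rewrite derivB derivXn derivX -mulr_natr -[m%:R]polyC_natr mL polyC0 mulr0
      sub0r.
  by rewrite -scaleN1r coprimepZr ?coprimep1 ?oppr_eq0 ?oner_neq0.
pose finL := FinFieldExtType L.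
have /finField_galois_generator[/= a _ Da] : (1 <= {:L})%VS by apply: sub1v.
rewrite dimv1 expn1 in Da.
pose Em := fixedSpace (a ^+ n)%g.
have in_zs : zs =i Em.
  move=> z; rewrite -root_prod_XsubC -(eqp_root Dq) (sameP fixedSpaceP eqP).
  rewrite /root !hornerE subr_eq0 /= /m; congr (_ == z).
  elim: (n) => [|i IHi]; first by rewrite gal_id.
  by rewrite expgSr expnSr exprM IHi galM ?Da ?memvf.
have defEm : Em = {:L}%VS.
  apply/eqP; rewrite eqEsubv subvf -defL -[Em]subfield_closed agenvS //.
  by rewrite subv_add sub1v; apply/span_subvP => z; rewrite in_zs.
have cE : finL =i zs by move=> z; rewrite in_zs defEm memvf.
have cL : #|finL| = m.
  apply: succn_inj; rewrite (eq_card cE) (card_uniqP _) //=.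
  rewrite -(size_prod_XsubC _ id) -(eqp_size Dq) size_polyDl size_polyXn //.
  by rewrite size_polyN size_polyX.
by apply: (@expnI #|F|) => //; rewrite -/m -cL card_finite_extension.
Qed.

Section FiniteExtensionRoots.
Variables (F : finFieldType) (L : fieldExtType F).
Local Notation "p ^%:A" := (map_poly (in_alg L) p)
  (at level 2, format "p ^%:A") : ring_scope.
Local Notation n := (\dim {:L}).
Local Notation Lf := (FinFieldExtType L).
Implicit Types (p f : {poly F}).

Lemma frobenius_fixed (E : fieldExtType F) (z : E) :
  z ^+ (#|F| ^ \dim <<1; z>>) = z.
Proof.
by apply/eqP; rewrite -[_ == _](Fermat's_little_theorem <<1; z>>%AS) memv_adjoin.
Qed.

(** A root z of f, in whatever extension, generates a field of degree n, hence
    satisfies z^(q^n) = z.  The multiple of f so obtained splits in L with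
    simple roots, hence so does f. *)
Lemma irreducible_dvd_genPoly f : irreducible_poly f -> size f = n.+1 ->
  f %| 'X^(#|F| ^ n) - 'X.
Proof.
move=> irr sf; have [E dimE [z fz _]] := irredp_FAdjoin irr.
rewrite -(root_irreducible _ irr fz) rmorphB /= map_polyXn map_polyX.
rewrite /root !hornerE subr_eq0.
by have := frobenius_fixed z; rewrite (dim_adjoin_irreducible irr fz) sf /= => ->.
Qed.

Lemma card_roots_irreducible f : irreducible_poly f -> size f = n.+1 ->
  #|[set x : Lf | root f^%:A x]| = n.
Proof.
move=> irr sf; have := irreducible_dvd_genPoly irr sf.
rewrite -(dvdp_map (in_alg L)) rmorphB /= map_polyXn map_polyX.
rewrite -card_finite_extension (finField_genPoly Lf) -big_enum.
move=> /dvdp_prod_XsubC[m fE].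
have um : uniq (mask m (enum Lf)) by rewrite mask_uniq ?enum_uniq.
have -> : #|[set x : Lf | root f^%:A x]| = size (mask m (enum Lf)).
  rewrite -(card_uniqP um); apply: eq_card => x.
  by rewrite inE (eqp_root fE) root_prod_XsubC.
apply: succn_inj; rewrite -sf -(size_prod_XsubC _ id) -(eqp_size fE).
by rewrite size_map_poly.
Qed.

(** An element of degree d < n is fixed by x |-> x^(q^d), where d is a proper
    divisor of n, hence at most n / 2. *)
Lemma card_small_degree : (0 < n)%N ->
  (#|[set x : Lf | \dim <<1; (x : L)>> != n]| <= 2 * #|F| ^ (n./2))%N.
Proof.
move=> n0; have q1 := finNzRing_gt1 F.
pose B k := [set x : Lf | [exists i : 'I_k, x ^+ (#|F| ^ i.+1) == x]].
have cB k : (#|B k| <= 2 * #|F| ^ k)%N.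
  elim: k => [|k IHk].
    have -> : B 0%N = set0; last by rewrite cards0.
    apply/setP => x; rewrite !inE.
    by apply/negbTE/negP => /existsP[[]].
  pose P := 'X^(#|F| ^ k.+1) - 'X : {poly Lf}.
  have qk1 : (1 < #|F| ^ k.+1)%N by rewrite -(expn0 #|F|) ltn_exp2l.
  have sP : size P = (#|F| ^ k.+1).+1.
    by rewrite size_polyDl size_polyXn // size_polyN size_polyX.
  have P0 : P != 0 by rewrite -size_poly_gt0 sP.
  have sub : B k.+1 \subset B k :|: [set x | root P x].
    apply/subsetP => x; rewrite !inE => /existsP[i xi].
    have [ik|ik] := ltnP i k.
      by apply/orP; left; apply/existsP; exists (Ordinal ik).
    apply/orP; right; rewrite /root !hornerE subr_eq0.
    suff <- : i = k :> nat by [].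
    by apply/eqP; rewrite eqn_leq ik -ltnS ltn_ord.
  apply: leq_trans (subset_leq_card sub) _.
  apply: leq_trans (leq_card_setU _ _).1 _.
  have := card_roots_le P0; rewrite sP ltnS => rP.
  apply: leq_trans (leq_add IHk rP) _.
  rewrite [X in (_ <= X)%N]mul2n -addnn leq_add2r expnS leq_mul2r.
  by rewrite q1 orbT.
apply: leq_trans (cB _); apply/subset_leq_card/subsetP => x; rewrite !inE => dx.
pose d := \dim <<1; (x : L)>>.
have dn : (d %| n)%N by apply: (@field_dimS _ _ <<1; (x : L)>>%AS {:L}%AS);
    exact: subvf.
have d0 : (0 < d)%N := dvdn_gt0 n0 dn.
have dle : (d <= n./2)%N.
  have /dvdnP[k nE] := dn; have k2 : (2 <= k)%N.
    case: k nE => [|[|//]] nE; first by rewrite nE in n0.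
    by rewrite nE mul1n eqxx in dx.
  by rewrite -(doubleK d) half_leq // nE -mul2n leq_mul2r k2 orbT.
have dk : (d.-1 < n./2)%N by rewrite prednK.
apply/existsP; exists (Ordinal dk); rewrite /= prednK //.
by apply/eqP; exact: frobenius_fixed.
Qed.
End FiniteExtensionRoots.

(** * Irreducibility of the substituted polynomial *)
Lemma homogenized_eval (E : fieldType) (p : {poly E}) n (G H : E) :
  (size p <= n.+1)%N ->
  \sum_(i < n.+1) p`_i * (G ^+ i * H ^+ (n - i)) =
  if H == 0 then p`_n * G ^+ n else H ^+ n * p.[G / H].
Proof.
move=> sp; case: eqVneq => [->|H0].
  rewrite big_ord_recr /= subnn expr0 mulr1 big1 ?add0r // => i _.
  by rewrite expr0n subn_eq0 leqNgt ltn_ord !mulr0.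
rewrite (horner_coef_wide _ sp) mulr_sumr; apply: eq_bigr => i _.
have -> : H ^+ n = H ^+ (n - i) * H ^+ i by rewrite -exprD subnK // -ltnS.
by rewrite expr_div_n; field; rewrite expf_neq0.
Qed.

Lemma root_ratsubst (F E : fieldType) (iota : {rmorphism F -> E})
    (g h f : {poly F}) n (x : E) :
    coprimep g h -> size f = n.+1 ->
  root (map_poly iota (ratsubst g h n f)) x =
  ((map_poly iota h).[x] != 0) &&
  root (map_poly iota f) ((map_poly iota g).[x] / (map_poly iota h).[x]).
Proof.
move=> cop sf; set G := (map_poly iota g).[x]; set H := (map_poly iota h).[x].
have -> : root (map_poly iota (ratsubst g h n f)) x =
    (\sum_(i < n.+1) (map_poly iota f)`_i * (G ^+ i * H ^+ (n - i)) == 0).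
  congr (_ == 0); rewrite /ratsubst rmorph_sum horner_sum; apply: eq_bigr => i _.
  by rewrite /= map_polyZ rmorphM !rmorphXn /= hornerZ hornerM !horner_exp
      coef_map.
rewrite homogenized_eval ?size_map_poly ?sf //; case: (eqVneq H 0) => [H0|H0] /=.
  rewrite mulf_eq0 expf_eq0 coef_map /= fmorph_eq0.
  have -> : f`_n == 0 = false.
    by rewrite -[n]/(n.+1.-1) -sf -/(lead_coef f) lead_coef_eq0 -size_poly_eq0 sf.
  apply/negbTE; rewrite /= negb_and; apply/orP; right.
  have copE : coprimep (map_poly iota h) (map_poly iota g).
    by rewrite coprimep_map coprimep_sym.
  exact: coprimep_root copE (introT rootP H0).
by rewrite mulf_eq0 expf_eq0 (negPf H0) andbF.
Qed.

Lemma coef_top_mul (F : fieldType) (p q : {poly F}) a b :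
  (size p <= a.+1)%N -> (size q <= b.+1)%N -> (p * q)`_(a + b) = p`_a * q`_b.
Proof.
move=> sp sq; have ab : (a < (a + b).+1)%N by rewrite ltnS leq_addr.
rewrite coefM (bigD1 (Ordinal ab)) //= addKn big1 ?addr0 // => i.
rewrite -val_eqE /= neq_ltn => /orP[ia|ai].
  by rewrite [q`_ _]nth_default ?mulr0 // (leq_trans sq) //; lia.
by rewrite nth_default ?mul0r // (leq_trans sp).
Qed.

Lemma coef_top_exp (F : fieldType) (p : {poly F}) a k :
  (size p <= a.+1)%N -> (p ^+ k)`_(a * k) = p`_a ^+ k.
Proof.
move=> sp; elim: k => [|k IHk]; first by rewrite muln0 !expr0 coef1.
by rewrite mulnS !exprS coef_top_mul ?IHk // size_exp_le.
Qed.

(** The coefficient of degree 3n is the homogenized value of f at the leading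
    pair of coefficients of g and h; it could only vanish at a root of f. *)
Lemma size_ratsubst (F : fieldType) (g h f : {poly F}) n :
    cubic_ratexpr g h -> size f = n.+1 -> (forall x, ~~ root f x) ->
  size (ratsubst g h n f) = (3 * n).+1.
Proof.
move=> cub sf fx; have [cop sg sh top] := cubic_ratexprP cub.
have sE : forall i : 'I_n.+1, (3 * i + 3 * (n - i) = 3 * n)%N.
  by move=> i; rewrite -mulnDr subnKC // -ltnS.
apply/eqP; rewrite eqn_leq; apply/andP; split.
  apply: leq_trans (size_sum _ _ _) _; apply/bigmax_leqP => i _; apply:
      size_scale_le.
  apply: size_mul_le (size_exp_le _ sg) (size_exp_le _ sh) _; by rewrite addSn
      addnS sE.
apply: contraT; rewrite -leqNgt => /leq_sizeP/(_ _ (leqnn _)) /eqP.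
rewrite /ratsubst coef_sum (eq_bigr
    (fun i : 'I_n.+1 => f`_i * (g`_3 ^+ i * h`_3 ^+ (n - i)))).
  rewrite homogenized_eval ?sf //; case: (eqVneq h`_3 0) => [h3|h3].
    rewrite mulf_eq0 expf_eq0 => /orP[|/andP[_ /eqP g3]]; last by case:
        (top g3 h3).
    by rewrite -[n]/(n.+1.-1) -sf -/(lead_coef f) lead_coef_eq0 -size_poly_eq0 sf.
  rewrite mulf_eq0 expf_eq0 (negPf h3) andbF /= => f0.
  by move: (fx (g`_3 / h`_3)); rewrite /root f0.
move=> i _; rewrite coefZ -(sE i) coef_top_mul ?size_exp_le // ?coef_top_exp //.
Qed.

Lemma irreducible_noroot (F : fieldType) (f : {poly F}) x :
  irreducible_poly f -> (2 < size f)%N -> ~~ root f x.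
Proof.
move=> [_ irr] sf; rewrite -dvdp_XsubCl; apply/negP => /irr.
rewrite size_XsubC => /(_ isT) /eqp_size; rewrite size_XsubC => s2.
by rewrite -s2 in sf.
Qed.

Section IrreducibleSubstitution.
Variables (F : finFieldType) (L : fieldExtType F) (g h : {poly F}).
Local Notation "p ^%:A" := (map_poly (in_alg L) p)
  (at level 2, format "p ^%:A") : ring_scope.
Local Notation n := (\dim {:L}).
Local Notation Lf := (FinFieldExtType L).
Hypotheses (cub : cubic_ratexpr g h) (n_gt1 : (1 < n)%N).
Variable f : {poly F}.
Hypotheses (irr : irreducible_poly f) (sf : size f = n.+1).
Local Notation P := (ratsubst g h n f).

Let n_gt0 : (0 < n)%N. Proof. exact: ltnW. Qed.

Lemma size_ratsubst_irr : size P = (3 * n).+1.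
Proof.
by apply: size_ratsubst => // x; apply: irreducible_noroot; rewrite // sf ltnS.
Qed.

(** Let z be a root of an irreducible factor r.  Then g(z) / h(z) is a root of f,
    of degree n, in the field generated by z, so that n divides the degree of
    r; and this degree is not n, otherwise r would have a root in L. *)
Lemma size_divisor_ratsubst (u : {poly F}) : (forall x : L, ~~ root P^%:A x) ->
  (1 < size u)%N -> u %| P -> (2 * n < size u)%N.
Proof.
have [cop _ _ _] := cubic_ratexprP cub; move=> noroot u1 uP.
have [r irr_r ru] := irreducible_factor u1.
have [E dimE [z rz _]] := irredp_FAdjoin irr_r.
have rP : r %| P := dvdp_trans ru uP.
have r1 : (1 < size r)%N by case: irr_r.
have u0 : u != 0 by rewrite -size_poly_gt0 ltnW.
apply: leq_trans (dvdp_leq u0 ru).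
have : root (map_poly (in_alg E) P) z by rewrite (root_irreducible _ irr_r rz).
rewrite root_ratsubst // => /andP[_ fa].
have dn : (n %| (size r).-1)%N.
  rewrite -dimE -[n]/(n.+1.-1) -sf -(dim_adjoin_irreducible irr fa).
  by apply: (@field_dimS _ _ <<1; _>>%AS {:E}%AS); exact: subvf.
have rn : (size r).-1 != n.
  apply/eqP => rn; have sr : size r = n.+1 by rewrite -rn prednK // ltnW.
  have /card_gt0P[x] : (0 < #|[set x : Lf | root r^%:A x]|)%N.
    by rewrite card_roots_irreducible.
  rewrite inE => rx; have := noroot x.
  by rewrite (root_irreducible _ irr_r rx) rP.
have r0 : (0 < (size r).-1)%N by rewrite -ltnS prednK // ltnW.
have /dvdnP[k rE] := dn; rewrite rE in rn r0.
rewrite -(prednK (ltnW r1)) ltnS rE leq_mul2r; apply/orP; right.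
by case: k rn r0 {rE} => [|[|]] //; rewrite mul1n eqxx.
Qed.

(** Two proper factors would each have degree at least 2n, while the product has
    degree 3n.  Conversely, a root in L has degree at most n. *)
Lemma irreducible_ratsubst :
  irreducible_poly P <-> forall x : L, ~~ root P^%:A x.
Proof.
split=> [irrP x|noroot].
  apply/negP => /(dim_adjoin_irreducible irrP); rewrite size_ratsubst_irr /= =>
      dx.
  by have := dimvS (subvf <<1; x>>); rewrite dx leqNgt ltn_Pmull.
have sP := size_ratsubst_irr; have P0 : P != 0 by rewrite -size_poly_gt0 sP.
split=> [|q q1 qP]; first by rewrite sP ltnS muln_gt0.
have q0 : q != 0 := dvdpN0 qP P0.
have PE : P = P %/ q * q by rewrite divpK.
have c0 : P %/ q != 0 by apply: contraNneq P0 => c0; rewrite PE c0 mul0r.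
have sq : (2 * n < size q)%N.
  apply: size_divisor_ratsubst => //.
  by rewrite ltn_neqAle eq_sym q1 size_poly_gt0.
have sc : (size (P %/ q)%R <= 1)%N.
  rewrite leqNgt; apply/negP => c1.
  have c2 := size_divisor_ratsubst noroot c1 (divp_dvd qP).
  have : size (P %/ q * q) = (3 * n).+1 by rewrite -PE.
  rewrite size_mul //; move: c2 sq n_gt0.
  move: (size (P %/ q)) (size q) => a b; move: (\dim _) => d; lia.
have /size_poly1P[b b0 bE] : size (P %/ q)%R == 1%N.
  by rewrite eqn_leq sc size_poly_gt0.
by rewrite eqp_sym PE bE mul_polyC eqp_scale.
Qed.

(** If x in L lies over a root b of f, then x = u(b) for some polynomial u over
    F, because b generates L.  The relation g(u(b)) = b h(u(b)) is
    polynomial in b with coefficients in F, so it holds for every root a of f,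
    and u(a) lies over a. *)
Lemma ratsubst_conjugate (a : L) : root f^%:A a ->
  (forall x : L, ~~ root P^%:A x) <->
  (forall x : L, g^%:A.[x] != a * h^%:A.[x]).
Proof.
have [cop _ _ _] := cubic_ratexprP cub; move=> fa.
have copA (x : L) : h^%:A.[x] = 0 -> g^%:A.[x] != 0.
  move=> hx; have copE : coprimep h^%:A g^%:A by rewrite coprimep_map
      coprimep_sym.
  exact: coprimep_root copE (introT rootP hx).
split=> noroot x; apply/negP.
  move=> /eqP e; have := noroot x; rewrite root_ratsubst // negb_and negbK.
  have h0 : h^%:A.[x] != 0.
    by apply/eqP => h0; have := copA x h0; rewrite e h0 mulr0 eqxx.
  by rewrite (negPf h0) e mulfK // fa.
rewrite root_ratsubst // => /andP[h0]; set b := _ / _ => fb.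
have gb : g^%:A.[x] = b * h^%:A.[x] by rewrite /b divfK.
have : x \in <<1; b>>%VS.
  suff -> : <<1; b>>%VS = {:L}%VS by rewrite memvf.
  apply/eqP; rewrite eqEdim subvf /= (dim_adjoin_irreducible irr fb) sf.
  by [].
move/Fadjoin1_polyP => [u ux].
pose w := g \Po u - 'X * (h \Po u).
have wE (y : L) : w^%:A.[y] = g^%:A.[u^%:A.[y]] - y * h^%:A.[u^%:A.[y]].
  rewrite /w rmorphB rmorphM /= map_polyX !map_comp_poly.
  by rewrite !hornerE !horner_comp.
have : root w^%:A a.
  rewrite (root_irreducible _ irr fa) -(root_irreducible _ irr fb).
  by rewrite /root wE -ux gb subrr.
by rewrite /root wE subr_eq0; apply/negP.
Qed.
End IrreducibleSubstitution.

(** * Counting *)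
Section CountIrreducible.
Variables (F : finFieldType) (L : fieldExtType F) (g h : {poly F}).
Local Notation "p ^%:A" := (map_poly (in_alg L) p)
  (at level 2, format "p ^%:A") : ring_scope.
Local Notation n := (\dim {:L}).
Local Notation Lf := (FinFieldExtType L).
Hypotheses (cub : cubic_ratexpr g h) (n_gt1 : (1 < n)%N).

(** Count the pairs of an admissible f and a root a of f in L: each f has n roots
    and each a of degree n has one minimal polynomial. *)
Lemma card_irr_set :
  (n * #|irr_set g h n| = #|[set a : Lf |
     (a \notin @ratimg Lf g^%:A h^%:A) && (\dim <<1; (a : L)>> == n)]|)%N.
Proof.
set B := [set a | _].
have cubA : @cubic_ratexpr Lf g^%:A h^%:A.
  by rewrite /cubic_ratexpr /ratdeg !size_map_poly coprimep_map.
have BP (f : {poly F}) (a : Lf) : irreducible_poly f -> size f = n.+1 -> root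
    f^%:A a ->
    (a \in B) = irreducibleb (ratsubst g h n f).
  move=> irr sf fa; rewrite inE (dim_adjoin_irreducible irr fa) sf eqxx andbT.
  apply/idP/irreducibleP => [aN|].
    apply/(irreducible_ratsubst cub n_gt1 irr sf).
    apply/(ratsubst_conjugate cub irr sf fa) => x.
    apply: contra aN => /eqP e; apply/imsetP.
    by have [xV xa] := (root_ratfun cubA x a).1 e; exists x.
  move/(irreducible_ratsubst cub n_gt1 irr sf).
  move/(ratsubst_conjugate cub irr sf fa) => noroot.
  apply/negP => /imsetP[x xV ax]; have /negP := noroot x; apply; apply/eqP.
  by apply/(root_ratfun cubA x a).2.
have dimB (a : Lf) : a \in B -> \dim <<1; (a : L)>> = n.
  by rewrite inE => /andP[_ /eqP].
have irrP (f : {poly_n.+1 F}) : f \in irr_set g h n ->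
    [/\ irreducible_poly f, size (f : {poly F}) = n.+1, (f : {poly F}) \is monic
      & irreducibleb (ratsubst g h n f)].
  by rewrite inE => /and4P[/eqP ? ? /irreducibleP ? ?].
rewrite mulnC -sum_nat_const -sum1_card.
transitivity (\sum_(f in irr_set g h n) \sum_(a in B)
    (root (f : {poly F})^%:A a : nat))%N.
  apply: eq_bigr => f /irrP[irr sf _ irrS].
  rewrite -[LHS](card_roots_irreducible irr sf) -sum1dep_card big_mkcond /=.
  rewrite [RHS]big_mkcond /=; apply: eq_bigr => a _.
  case fa : (root _ a); last by case: ifP.
  by rewrite (BP f) // irrS.
rewrite exchange_big /=; apply: eq_bigr => a aB.
have [f fE irr] := minPoly_base (a : L).
have fa : root f^%:A a by rewrite fE root_minPoly.
have sf : size f = n.+1.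
  rewrite -(dimB _ aB) (dim_adjoin_irreducible irr fa) prednK //.
  by case: irr => s1 _; exact: ltnW.
have monf : f \is monic by rewrite -(map_monic (in_alg L)) fE monic_minPoly.
have sf' : (size f <= n.+1)%N by rewrite sf.
pose f' : {poly_n.+1 F} := NPoly sf'.
have f'I : f' \in irr_set g h n.
  rewrite inE /= sf eqxx monf /=; apply/andP; split; first exact/irreducibleP.
  by rewrite -(BP f a).
rewrite (bigD1 f') //= fa big1 ?addn0 // => k /andP[/irrP[irrk sk monk _] kf].
have [ka|//] := boolP (root _ a); case/eqP: kf; apply/val_inj => /=.
apply/eqP; rewrite -eqp_monic // /eqp -(root_irreducible _ irrk ka) fa.
by rewrite -(root_irreducible _ irr fa) ka.
Qed.
End CountIrreducible.

Lemma generic_ratexpr_map (F E : fieldType) (iota : {rmorphism F -> E})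
    (g h : {poly F}) :
  generic_ratexpr g h -> generic_ratexpr (map_poly iota g) (map_poly iota h).
Proof.
move=> [two W0 sep sD]; split.
- by rewrite -(rmorph_nat iota) fmorph_eq0.
- by rewrite -map_ram_poly map_poly_eq0.
- by rewrite -map_companion_disc separable_map.
- by rewrite -map_companion_disc size_map_poly.
Qed.

Lemma card_irr_set_bound (R : realFieldType) (F : finFieldType) (g h : {poly F})
    (n : nat) (s : R) :
    cubic_ratexpr g h -> generic_ratexpr g h -> (1 < n)%N ->
    0 <= s -> s ^+ 2 = #|F|%:R ^+ n ->
  `|3 * (n * #|irr_set g h n|)%:R - #|F|%:R ^+ n| <= 41 * s.
Proof.
move=> cub good n1 s0 sE; have [L dimL] := finite_extension F (ltnW n1).
have n1' : (1 < \dim {:L})%N by rewrite dimL.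
have := card_irr_set cub n1'; have := card_small_degree (ltnW n1').
rewrite dimL; set B := [set a | _ && _]; set Sm := [set x | _] => cSm ->.
pose gA : {poly FinFieldExtType L} := map_poly (in_alg L) g.
pose hA : {poly FinFieldExtType L} := map_poly (in_alg L) h.
have cubA : cubic_ratexpr gA hA.
  by rewrite /cubic_ratexpr /ratdeg !size_map_poly coprimep_map.
have goodA : generic_ratexpr gA hA := generic_ratexpr_map (in_alg L) good.
have cL : #|FinFieldExtType L| = (#|F| ^ n)%N by rewrite card_finite_extension
    dimL.
have := card_ratimgC cubA goodA s0; rewrite cL natrX => /(_ sE).
set A := ~: _ => cA.
have BA : (#|B| <= #|A| <= #|B| + #|Sm|)%N.
  apply/andP; split.
    by apply/subset_leq_card/subsetP => x; rewrite !inE => /andP[].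
  apply: leq_trans (leq_card_setU _ _).1.
  by apply/subset_leq_card/subsetP => x; rewrite !inE => ->; case: eqVneq.
have sms : #|Sm|%:R <= 2 * s.
  apply: (@le_trans _ _ (2 * #|F| ^ n./2)%:R); first by rewrite ler_nat.
  rewrite natrM ler_pM2l ?ltr0n // -(@ler_pXn2r _ 2) ?nnegrE ?ler0n //.
  rewrite sE -!natrX ler_nat -expnM leq_exp2l ?finNzRing_gt1 //.
  by rewrite muln2 -[leqRHS]odd_double_half leq_addl.
have /andP[] := BA; rewrite -!(ler_nat R) natrD => le1 le2.
move: cA; rewrite !ler_norml => /andP[lo hi]; apply/andP; split; lra.
Qed.

Theorem theorem14 (R : realType) :
  exists C : R,
    forall (F : finFieldType) (K : closedFieldType)
      (iota : {rmorphism F -> K}) (g h : {poly F}) (n : nat),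
      is_algebraic_closure iota ->
      cubic_ratexpr g h ->
      has_nb_ram_points iota g h 4 ->
      (1 < n)%N ->
      `| #|irr_set g h n|%:R - #|F|%:R ^+ n / (3 * n%:R) |
        <= C * (#|F|%:R `^ (n%:R / 2) / n%:R).
Proof.
(* 14 > 41 / 3: the bound for the numbers multiplied by 3n is divided by 3n. *)
exists 14 => F K iota g h n _ cub ram n1.
set s := _ `^ _; have s0 : 0 <= s := powR_ge0 _ _.
have sE : s ^+ 2 = #|F|%:R ^+ n.
  by rewrite -powR_mulrn // /s -powRrM divfK ?pnatr_eq0 // powR_mulrn ?ler0n.
have := card_irr_set_bound cub (generic_ratexpr_ram4 cub ram) n1 s0 sE.
rewrite natrM; set I := #|_|%:R; set Q := _ ^+ n => bnd.
have n0 : 0 < n%:R :> R by rewrite ltr0n ltnW.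
have n3 : 0 < 3 * n%:R :> R by apply: mulr_gt0 => //; rewrite ltr0n.
have -> : I - Q / (3 * n%:R) = (3 * (n%:R * I) - Q) / (3 * n%:R).
  by field; rewrite gt_eqF.
rewrite normrM normfV (gtr0_norm n3) ler_pdivrMr //.
have -> : 14 * (s / n%:R) * (3 * n%:R) = 42 * s by field; rewrite gt_eqF.
lra.
Qed.
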